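(* Let $K\ge1$, $l\in\mathbb{R}_+^K$, $\varepsilon\ge0$, $C\in\mathbb{R}_+^{K\times K}$ and $D\in\{0,1\}^{K\times K}$, with $C$ and $D$ having zero diagonals, and let $\psi$ be the associated audit value function. Let $\alpha\in(0,1)$, and let $m=m(n)$ satisfy $m\to\infty$ and $m/n\to0$ as $n\to\infty$. For any $f_\star\in\Delta_K$, if $nf_n\sim\operatorname{Multinomial}(n;f_\star)$ and $c_q^*$ denotes the $q$-th quantile of the $m$-out-of-$n$ bootstrap distribution, then $$\liminf_{n\to\infty}\ \mathbb{P}\left(\psi(f_\star)\in\left[\psi(f_n)-\frac{c^*_{1-\alpha/2}}{\sqrt n},\ \psi(f_n)-\frac{c^*_{\alpha/2}}{\sqrt n}\right]\right)\ge 1-\alpha.$$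
   Context: $\Delta_K=\{x\in\mathbb{R}_+^K:\mathbf{1}_K^\top x=1\}$ is the probability simplex; $\mathbf{1}_K$ is the all-ones vector; $\langle A,B\rangle=\sum_{i,j}A_{ij}B_{ij}$. The audit value function $\psi:\Delta_K\to\mathbb{R}_+$ associated with $(l,\varepsilon,C,D)$ is $$\psi(f)=\max_{\Pi\in\mathbb{R}_+^{K\times K}}\ l^\top(\Pi^\top\mathbf{1}_K-f)\quad\text{subject to}\quad\langle C,\Pi\rangle\le\varepsilon,\ \ \langle D,\Pi\rangle=0,\ \ \Pi\mathbf{1}_K=f.$$ The zero diagonals of $C$ and $D$ make the problem feasible for every $f\in\Delta_K$. Bootstrap quantiles: given $f_n$, let $f_{n,m}^*$ be such that $m f_{n,m}^*\sim\operatorname{Multinomial}(m;f_n)$ conditionally on $f_n$; for $0\le q\le1$, $$c_q^*=\inf\{c\in\mathbb{R}:\ \mathbb{P}(\sqrt m\{\psi(f_{n,m}^* )-\psi(f_n)\}\le c\mid f_n)\ge q\}.$$ (The quantile is the exact conditional quantile; Monte Carlo error is ignored.) *)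

(* Defs.v *)
From HB Require Import structures.
From mathcomp Require Import all_boot all_order all_algebra.
From mathcomp Require Import all_classical all_reals all_analysis.

Set Implicit Arguments.
Unset Strict Implicit.
Unset Printing Implicit Defensive.

Import Order.TTheory GRing.Theory Num.Theory.
Import numFieldNormedType.Exports.

Local Open Scope classical_set_scope.
Local Open Scope ring_scope.

Definition simplex (R : realType) (K : nat) : set 'cV[R]_K :=
  [set x | (forall i, 0 <= x i 0) /\ \sum_i x i 0 = 1].

Definition mx_inner (R : realType) (K : nat) (A B : 'M[R]_K) : R :=
  \sum_i \sum_j A i j * B i j.

Definition audit_feasible (R : realType) (K : nat) (eps : R) (C D : 'M[R]_K)
    (f : 'cV[R]_K) : set 'M[R]_K :=
  [set Pi : 'M[R]_K | [/\ forall i j, 0 <= Pi i j,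
                mx_inner C Pi <= eps,
                mx_inner D Pi = 0 &
                Pi *m const_mx 1 = f]].

Definition audit_objective (R : realType) (K : nat) (l f : 'cV[R]_K)
    (Pi : 'M[R]_K) : R :=
  (l^T *m (Pi^T *m const_mx 1 - f)) 0 0.

(* The maximum is taken as a supremum; audit_value_max shows that it is
   attained for every f in the simplex. *)
Definition audit_value (R : realType) (K : nat) (l : 'cV[R]_K) (eps : R)
    (C D : 'M[R]_K) (f : 'cV[R]_K) : R :=
  sup (audit_objective l f @` audit_feasible eps C D f).

Definition multinomial_pmf (R : realType) (K : nat) (n : nat) (p : 'cV[R]_K)
    (k : 'I_K -> nat) : R :=
  if (\sum_i k i)%N == n
  then n`!%:R / (\prod_i (k i)`!)%N%:R * \prod_i p i 0 ^+ k i
  else 0.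

Definition multinomial_rv d (T : measurableType d) (R : realType)
    (P : probability T R) (K : nat) (n : nat) (p : 'cV[R]_K)
    (X : 'I_K -> {RV P >-> nat}) : Prop :=
  forall k : 'I_K -> nat,
    P [set w | forall i, X i w = k i] = (multinomial_pmf n p k)%:E.

(* The law Multinomial(n; p) of an event A; the counts are at most n, so the
   sum over {0, ..., n}^K exhausts the support. *)
Definition multinomial_law (R : realType) (K : nat) (n : nat) (p : 'cV[R]_K)
    (A : set ('I_K -> nat)) : R :=
  \sum_(k : {ffun 'I_K -> 'I_n.+1} | (fun i => k i : nat) \in A)
    multinomial_pmf n p (fun i => k i : nat).

Definition freq (R : realType) (K : nat) (n : nat) (k : 'I_K -> nat) :
    'cV[R]_K :=
  \col_i ((k i)%:R / n%:R).

(* c |-> P(sqrt m (psi f* - psi f) <= c) when m f* ~ Multinomial(m; f); at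
   f = f_n this is the bootstrap distribution conditional on f_n. *)
Definition bootstrap_cdf (R : realType) (K : nat) (psi : 'cV[R]_K -> R)
    (m : nat) (f : 'cV[R]_K) (c : R) : R :=
  multinomial_law m f
    [set k | Num.sqrt m%:R * (psi (freq R m k) - psi f) <= c].

(* For f in the simplex and 0 < q <= 1 the set below is nonempty and bounded
   from below, so that inf is a genuine infimum; for q = 0 the infimum would be
   -oo, and inf returns a default value. *)
Definition bootstrap_quantile (R : realType) (K : nat) (psi : 'cV[R]_K -> R)
    (m : nat) (f : 'cV[R]_K) (q : R) : R :=
  inf [set c : R | q <= bootstrap_cdf psi m f c].

Lemma vec_mx_entry_continuous (R : realType) (K : nat) (i j : 'I_K) :
  continuous (fun v : 'rV[R]_(K * K) => vec_mx v i j).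
Proof.
move=> v; rewrite /continuous_at.
under eq_fun do rewrite mxE.
rewrite mxE; exact: coord_continuous.
Qed.

Lemma sum_continuous (R : realType) (T : topologicalType) (I : finType)
    (F : I -> T -> R) :
  (forall i, continuous (F i)) -> continuous (fun x => \sum_i F i x).
Proof.
move=> cF x; apply: cvg_big => [|i _]; last exact: cF.
exact: add_continuous.
Qed.

Lemma scale_continuous (R : realType) (T : topologicalType) (a : R)
    (F : T -> R) :
  continuous F -> continuous (fun x => a * F x).
Proof. move=> cF x; exact (@cvgMl_tmp R T (nbhs x) _ F a (F x) (cF x)). Qed.

Lemma mx_inner_vec_continuous (R : realType) (K : nat) (A : 'M[R]_K) :
  continuous (fun v : 'rV[R]_(K * K) => mx_inner A (vec_mx v)).
Proof.
apply: sum_continuous => i; apply: sum_continuous => j.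
apply: scale_continuous; exact: vec_mx_entry_continuous.
Qed.

Lemma audit_objective_vec_continuous (R : realType) (K : nat) (l f : 'cV[R]_K) :
  continuous (fun v : 'rV[R]_(K * K) => audit_objective l f (vec_mx v)).
Proof.
have -> : (fun v : 'rV[R]_(K * K) => audit_objective l f (vec_mx v)) =
    (fun v => \sum_i l i 0 * (\sum_j vec_mx v j i + - f i 0)).
  apply/funext => v; rewrite /audit_objective mxE; apply: eq_bigr => i _.
  rewrite !mxE; congr (_ * (_ - _)); apply: eq_bigr => j _.
  by rewrite mxE [X in _ * X]mxE mulr1.
apply: sum_continuous => i; apply: scale_continuous => v.
apply: (@cvgB R R^o _ (nbhs v) _ _ (fun=> f i 0)); last exact: cvg_cst.
by apply: sum_continuous => j; exact: vec_mx_entry_continuous.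
Qed.

Lemma audit_feasible_diag (R : realType) (K : nat) (eps : R) (C D : 'M[R]_K)
    (f : 'cV[R]_K) :
  0 <= eps -> (forall i, C i i = 0) -> (forall i, D i i = 0) ->
  simplex f ->
  audit_feasible eps C D f (diag_mx f^T).
Proof.
move=> eps0 Cdiag Ddiag [f0 f1].
have inner0 (A : 'M[R]_K) : (forall i, A i i = 0) -> mx_inner A (diag_mx f^T) = 0.
  move=> A0; rewrite /mx_inner big1// => i _; rewrite big1// => j _.
  rewrite !mxE; have [->|_] := eqVneq i j; first by rewrite A0 mul0r.
  by rewrite mulr0n mulr0.
split.
- by move=> i j; rewrite !mxE mulrn_wge0.
- by rewrite inner0.
- exact: inner0.
- apply/colP => i; rewrite mxE (bigD1 i)//= !mxE eqxx mulr1 mulr1n.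
  rewrite big1 ?addr0// => j ji.
  by rewrite !mxE eq_sym (negbTE ji) mulr0n mul0r.
Qed.

Lemma audit_feasible_vec_compact (R : realType) (K : nat) (eps : R) (C D : 'M[R]_K)
    (f : 'cV[R]_K) :
  simplex f ->
  compact [set v : 'rV[R]_(K * K) | audit_feasible eps C D f (vec_mx v)].
Proof.
move=> [f0 f1].
pose S1 := \bigcap_(ij in [set: 'I_K * 'I_K])
  (fun v : 'rV[R]_(K * K) => vec_mx v ij.1 ij.2) @^-1` [set x : R | 0 <= x].
pose S2 := (fun v : 'rV[R]_(K * K) => mx_inner C (vec_mx v)) @^-1` [set x | x <= eps].
pose S3 := (fun v : 'rV[R]_(K * K) => mx_inner D (vec_mx v)) @^-1` [set 0].
pose S4 := \bigcap_(i in [set: 'I_K])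
  (fun v : 'rV[R]_(K * K) => \sum_j vec_mx v i j) @^-1` [set f i 0].
have row_sum (v : 'rV[R]_(K * K)) i :
    (vec_mx v *m const_mx 1 : 'cV[R]_K) i 0 = \sum_j vec_mx v i j.
  by rewrite mxE; apply: eq_bigr => j _; rewrite [X in _ * X]mxE mulr1.
have -> : [set v : 'rV[R]_(K * K) | audit_feasible eps C D f (vec_mx v)] =
    S1 `&` S2 `&` S3 `&` S4.
  apply/seteqP; split => v /=.
    move=> [v0 vC vD vf]; do 3?split => //.
      by move=> [i j] _ /=; exact: v0.
    by move=> i _ /=; rewrite -row_sum vf.
  move=> [[[v0 vC] vD] vf]; split => //.
    by move=> i j; exact: (v0 (i, j)).
  by apply/colP => i; rewrite row_sum; exact: vf.
apply: bounded_closed_compact.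
  exists 1; split; first exact: num_real.
  move=> M M1 v [[[v0 _] _] vf].
  have M0 : 0 <= M by rewrite (le_trans ler01)// ltW.
  have fle i : f i 0 <= 1.
    by rewrite -f1 (bigD1 i)//= lerDl sumr_ge0.
  rewrite /Num.norm/= mx_normrE; apply/bigmax_leP; split => //= -[i0 k] _ /=.
  rewrite ord1; case/mxvec_indexP: k => i j.
  have -> : v 0 (mxvec_index i j) = vec_mx v i j by rewrite mxE.
  have v0' j' : 0 <= vec_mx v i j' by exact: (v0 (i, j')).
  rewrite ger0_norm//; apply: (le_trans _ (ltW M1)); apply: (le_trans _ (fle i)).
  have <- : \sum_j vec_mx v i j = f i 0 by exact: vf.
  by rewrite (bigD1 j)//= lerDl sumr_ge0.
apply: closedI; [apply: closedI; [apply: closedI|]|].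
- apply: closed_bigI => -[i j] _.
  apply: preimage_closed; last exact: closed_ge.
  by move=> v _; exact: vec_mx_entry_continuous.
- apply: preimage_closed; last exact: closed_le.
  by move=> v _; exact: mx_inner_vec_continuous.
- apply: preimage_closed; last exact: closed_eq.
  by move=> v _; exact: mx_inner_vec_continuous.
- apply: closed_bigI => i _.
  apply: preimage_closed; last exact: closed_eq.
  by move=> v _; apply: sum_continuous => j; exact: vec_mx_entry_continuous.
Qed.

Lemma audit_value_max (R : realType) (K : nat) (l : 'cV[R]_K) (eps : R)
    (C D : 'M[R]_K) (f : 'cV[R]_K) :
  0 <= eps -> (forall i, C i i = 0) -> (forall i, D i i = 0) ->
  simplex f ->
  exists2 Pi, audit_feasible eps C D f Pi &
    audit_objective l f Pi = audit_value l eps C D f /\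
    forall Pi', audit_feasible eps C D f Pi' ->
      audit_objective l f Pi' <= audit_objective l f Pi.
Proof.
move=> eps0 Cdiag Ddiag sf; pose A := [set v : 'rV[R]_(K * K) | audit_feasible eps C D f (vec_mx v)].
have A0 : A !=set0.
  by exists (mxvec (diag_mx f^T)); rewrite /A/= mxvecK; exact: audit_feasible_diag.
have cobj : {within A, continuous (fun v => audit_objective l f (vec_mx v))}.
  by apply: continuous_subspaceT; exact: audit_objective_vec_continuous.
have [v /set_mem Av vmax] :=
  compact_EVT_max A0 (audit_feasible_vec_compact sf) cobj.
have vmax' Pi : audit_feasible eps C D f Pi ->
    audit_objective l f Pi <= audit_objective l f (vec_mx v).
  move=> FPi; rewrite -[Pi]mxvecK; apply: vmax; apply/mem_set.
  by rewrite /A/= mxvecK.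
exists (vec_mx v) => //; split => //; apply/le_anti/andP; split.
- apply: ub_le_sup; last by exists (vec_mx v).
  by exists (audit_objective l f (vec_mx v)) => _ [Pi FPi <-]; exact: vmax'.
- apply: ge_sup; first by exists (audit_objective l f (vec_mx v)), (vec_mx v).
  by move=> _ [Pi FPi <-]; exact: vmax'.
Qed.

(* Main.v *)
(* psi is a minimum of finitely many linear forms on the simplex, by Fourier-Motzkin
   elimination of Pi. Near fstar, psi - psi fstar is thus the minimum of the forms
   active at fstar; those with positive variance under fstar give a statistic without
   atoms in the limit, those with variance zero vanish on the face of fstar and can
   only produce an atom at 0, the largest possible value.
   The laws of sqrt n (f_n - fstar) and sqrt m (f* - f_n) are compared directly by
   Lindeberg replacement against smoothed indicators of boxes, without a Gaussian
   limit: n steps of size 1/sqrt n and m steps of size 1/sqrt m are both compared with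
   n m steps of size 1/sqrt(n m). Anticoncentration comes from the same comparison with
   Rademacher sums, whose atoms are central binomial coefficients.
   Coverage then needs no limiting quantile: if F is the law function of
   T = sqrt n (psi f_n - psi fstar) and F* the bootstrap one, then F* >= F - o(1) at T
   itself, so T < c*_q forces F(T) < q + o(1), which has probability at most q + o(1).
   At the atom (T = 0 with a vanishing active form) F*(0) = 1 whatever F is, because
   then no bootstrap draw can exceed psi f_n. *)

Require Import Defs.
From HB Require Import structures.
From mathcomp Require Import all_boot all_order all_algebra.
From mathcomp Require Import all_classical all_reals all_analysis.
From mathcomp Require Import zify ring lra.

Set Implicit Arguments.
Unset Strict Implicit.
Unset Printing Implicit Defensive.

Import Order.TTheory GRing.Theory Num.Theory.
Import numFieldNormedType.Exports.

Local Open Scope classical_set_scope.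
Local Open Scope ring_scope.

(** * Smoothed indicators of boxes *)

(** The laws are compared at a random threshold, the observed [T], and one of them has the random
    parameter f_n. Every comparison therefore needs an error constant depending on neither: [B] is
    always fixed before the laws, the sample sizes and the threshold, and the laws enter only
    through covariances and a common fourth-moment bound. A minimum of forms exceeds x exactly when
    all of them do, so boxes with one common threshold are the only events to smooth. A minimum
    close to x forces a single form to be close to x; hence positive variance of each form suffices
    and the joint covariance may be singular. The bootstrap is centred at f_n while [psi] may have a
    kink at [fstar]. Recentring moves each form by a multiple of sqrt m (f_n - fstar), which
    Chebyshev makes small when m/n tends to 0. Anticoncentration then absorbs this shift together
    with the width of the smoothing. Laws are positive normalized linear functionals on arbitrary
    functions, realized by finite sums; measurability enters only when probabilities under [P] are
    finally rewritten as such sums. *)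

Definition pos3 (R : realType) (t : R) : R := Num.max t 0 ^+ 3.

(** The second derivative [6 * Num.max t 0] is 6-Lipschitz, which gives the remainder constant 6/3!
    = 1. *)
Lemma pos3_taylor (R : realType) (t s : R) :
  `|pos3 (t + s) - pos3 t - 3 * Num.max t 0 ^+ 2 * s
     - 3 * Num.max t 0 * s ^+ 2| <= `|s| ^+ 3.
Proof.
rewrite /pos3.
have e3 (u : R) : `|u ^+ 3| = `|u| ^+ 3 by rewrite normrX.
have [t0|t0] := leP t 0; have [s0|s0] := leP (t + s) 0.
- rewrite (_ : _ - _ = 0); last by ring.
  by rewrite normr0 exprn_ge0.
- rewrite (_ : _ - _ = (t + s) ^+ 3); last by ring.
  rewrite e3; apply: lerXn2r; rewrite ?nnegrE// !ger0_norm; lra.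
- rewrite (_ : _ - _ = s ^+ 3 - (t + s) ^+ 3); last by ring.
  have sn : s < 0 by lra.
  have h : 0 <= (- (t + s)) ^+ 3 <= (- s) ^+ 3.
    rewrite exprn_ge0 ?lerXn2r ?nnegrE//; lra.
  have e (u : R) : (- u) ^+ 3 = - u ^+ 3 by ring.
  rewrite (ltr0_norm sn); rewrite !e in h *.
  by rewrite ler_norml; lra.
- rewrite (_ : _ - _ = s ^+ 3); last by ring.
  by rewrite e3.
Qed.

(* Integrated cubic B-spline: a C^2 step with Lipschitz second derivative,
   rising from 0 to 1 on [0, 3]. *)
Definition step (R : realType) (t : R) : R :=
  (pos3 t - 3 * pos3 (t - 1) + 3 * pos3 (t - 2) - pos3 (t - 3)) / 6.

Definition step1 (R : realType) (t : R) : R :=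
  (Num.max t 0 ^+ 2 - 3 * Num.max (t - 1) 0 ^+ 2 + 3 * Num.max (t - 2) 0 ^+ 2
   - Num.max (t - 3) 0 ^+ 2) / 2.

(** Half of the second derivative of [step], that is, its quadratic Taylor coefficient. *)
Definition step2 (R : realType) (t : R) : R :=
  (Num.max t 0 - 3 * Num.max (t - 1) 0 + 3 * Num.max (t - 2) 0
   - Num.max (t - 3) 0) / 2.

(** The four remainders add up to (1 + 3 + 3 + 1)/6 = 4/3, rounded up to 2. *)
Lemma step_taylor (R : realType) (t s : R) :
  `|step (t + s) - step t - step1 t * s - step2 t * s ^+ 2|
    <= 2 * `|s| ^+ 3.
Proof.
have h0 := pos3_taylor t s.
have h1 := pos3_taylor (t - 1) s.
have h2 := pos3_taylor (t - 2) s.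
have h3 := pos3_taylor (t - 3) s.
rewrite /step /step1 /step2.
rewrite !(addrAC t s).
move: h0 h1 h2 h3; set z := `|s| ^+ 3.
have z0 : 0 <= z by rewrite exprn_ge0.
rewrite !ler_norml => /andP[a1 a2] /andP[b1 b2] /andP[c1 c2] /andP[d1 d2].
apply/andP; split; lra.
Qed.

Lemma step_le0 (R : realType) (t : R) : t <= 0 -> step t = 0.
Proof.
by move=> t0; rewrite /step /pos3 !max_r; first (by ring); lra.
Qed.

Lemma step_ge3 (R : realType) (t : R) : 3 <= t -> step t = 1.
Proof.
by move=> t0; rewrite /step /pos3 !max_l; first (by field); lra.
Qed.

Lemma step_bounds (R : realType) (t : R) :
  [/\ 0 <= step t <= 1, `|step1 t| <= 2 & `|step2 t| <= 2].
Proof.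
have [t0|t0] := leP t 0.
  rewrite step_le0// /step1 /step2 !max_r; [|lra..].
  by rewrite expr0n/= !(mulr0, subr0, addr0, mul0r, normr0); split; rewrite ?lexx ?ler01.
have [t3|t3] := leP 3 t.
  rewrite step_ge3// /step1 /step2 !max_l; [|lra..].
  by split; [rewrite lexx ler01| rewrite ler_norml; apply/andP; split; lra..].
rewrite /step /pos3 /step1 /step2 (max_l (ltW t0)).
rewrite (@max_r _ _ (t - 3) 0); last lra.
have [t1|t1] := leP t 1; last have [t2|t2] := leP t 2.
- rewrite (@max_r _ _ (t - 1) 0); last lra.
  rewrite (@max_r _ _ (t - 2) 0); last lra.
  split; rewrite ?ler_norml; apply/andP; split; nra.
- rewrite (@max_l _ _ (t - 1) 0); last lra.
  rewrite (@max_r _ _ (t - 2) 0); last lra.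
  have [u eu] : exists u, u = t - 1 by exists (t - 1).
  have -> : (t ^+ 3 - 3 * (t - 1) ^+ 3 + 3 * 0 ^+ 3 - 0 ^+ 3) / 6 =
    (1 + 3 * u + u ^+ 2 * (3 - 2 * u)) / 6 by rewrite eu; field.
  (* Sign certificates on the middle piece: the value is (1 + 3u + u^2(3 - 2u))/6, and one minus it
     is (4 - 3u + (1 - u)^2(1 + 2u))/6. *)
  have h1 : 0 <= u ^+ 2 * (3 - 2 * u) by rewrite mulr_ge0 ?sqr_ge0//; lra.
  have h2 : 0 <= (1 - u) ^+ 2 * (1 + 2 * u) by rewrite mulr_ge0 ?sqr_ge0//; lra.
  split; rewrite ?ler_norml; apply/andP; split; nra.
- rewrite (@max_l _ _ (t - 1) 0); last lra.
  rewrite (@max_l _ _ (t - 2) 0); last lra.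
  have e : (t ^+ 3 - 3 * (t - 1) ^+ 3 + 3 * (t - 2) ^+ 3 - 0 ^+ 3) / 6 =
     1 - (3 - t) ^+ 3 / 6 by field.
  have : 0 <= (3 - t) ^+ 3 <= 1.
    rewrite exprn_ge0 ?exprn_ile1//; lra.
  rewrite e; split; rewrite ?ler_norml; apply/andP; split; nra.
Qed.

(** * Functions with a uniform second-order expansion *)

Definition norm1 (R : realType) k (v : 'cV[R]_k) : R := \sum_a `|v a 0|.

Lemma norm1_ge0 (R : realType) k (v : 'cV[R]_k) : 0 <= norm1 v.
Proof. by apply: sumr_ge0. Qed.

Lemma ler_norm1 (R : realType) k (v : 'cV[R]_k) a : `|v a 0| <= norm1 v.
Proof. by rewrite /norm1 (bigD1 a)//= lerDl sumr_ge0. Qed.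

Definition lin_part (R : realType) k (g : 'I_k -> R) (v : 'cV[R]_k) : R :=
  \sum_a g a * v a 0.

Definition quad_part (R : realType) k (h : 'I_k -> 'I_k -> R) (v : 'cV[R]_k) : R :=
  \sum_a \sum_b h a b * (v a 0 * v b 0).

Lemma lin_part_le (R : realType) k (g : 'I_k -> R) (M : R) v :
  (forall a, `|g a| <= M) -> `|lin_part g v| <= M * norm1 v.
Proof.
move=> gM; rewrite /lin_part /norm1 mulr_sumr (le_trans (ler_norm_sum _ _ _))//.
by apply: ler_sum => a _; rewrite normrM ler_wpM2r.
Qed.

Lemma quad_part_le (R : realType) k (h : 'I_k -> 'I_k -> R) (M : R) v :
  (forall a b, `|h a b| <= M) -> `|quad_part h v| <= M * norm1 v ^+ 2.
Proof.
move=> hM; rewrite /quad_part expr2 {1}/norm1 mulrCA mulr_suml.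
rewrite (le_trans (ler_norm_sum _ _ _))//; apply: ler_sum => a _.
rewrite {1}/norm1 !mulr_sumr (le_trans (ler_norm_sum _ _ _))//.
apply: ler_sum => b _.
by rewrite !normrM [leRHS]mulrCA ler_wpM2r// mulr_ge0.
Qed.

(** Encoded by an expansion with bounded coefficients, valid for increments of any size, rather than
    by derivatives: this form passes to averages with the same [M] and to products. [H] plays the
    role of half the Hessian and need not be symmetric. *)
Definition smooth (R : realType) k (M : R) (phi : 'cV[R]_k -> R) : Prop :=
  exists (G : 'cV[R]_k -> 'I_k -> R) (H : 'cV[R]_k -> 'I_k -> 'I_k -> R),
  forall x, [/\ `|phi x| <= M, forall a, `|G x a| <= M,
    forall a b, `|H x a b| <= M &
    forall v, `|phi (x + v) - phi x - lin_part (G x) v - quad_part (H x) v|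
       <= M * norm1 v ^+ 3].

Lemma smooth_const (R : realType) k (c : R) : smooth `|c| (fun _ : 'cV[R]_k => c).
Proof.
exists (fun _ _ => 0), (fun _ _ _ => 0) => x; split => //.
- by move=> a; rewrite normr0.
- by move=> a b; rewrite normr0.
- move=> v; rewrite subrr /lin_part /quad_part big1 => [|a _]; last by rewrite mul0r.
  rewrite big1 => [|a _]; last by rewrite big1 // => b _; rewrite mul0r.
  by rewrite !subr0 normr0 mulr_ge0// exprn_ge0// norm1_ge0.
Qed.

Lemma ler_norm_sum7 (R : realType) (B x1 x2 x3 x4 x5 x6 x7 : R) :
  `|x1| <= B -> `|x2| <= B -> `|x3| <= B -> `|x4| <= B -> `|x5| <= B ->
  `|x6| <= B -> `|x7| <= B -> `|x1 + x2 + x3 + x4 + x5 + x6 + x7| <= 7 * B.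
Proof. by rewrite !ler_norml; lra. Qed.

Lemma mul_remainder_le (R : realType) (M1 M2 n f f' a1 a2 g g' b1 b2 : R) :
  0 <= n ->
  `|f| <= M1 -> `|f'| <= M1 -> `|a1| <= M1 * n -> `|a2| <= M1 * n ^+ 2 ->
  `|f' - f - a1 - a2| <= M1 * n ^+ 3 ->
  `|g| <= M2 -> `|g'| <= M2 -> `|b1| <= M2 * n -> `|b2| <= M2 * n ^+ 2 ->
  `|g' - g - b1 - b2| <= M2 * n ^+ 3 ->
  `|f' * g' - f * g - (f * b1 + g * a1) - (f * b2 + g * a2 + a1 * b1)|
    <= 7 * (M1 * M2) * n ^+ 3.
Proof.
move=> n0 fM f'M a1M a2M rM gM g'M b1M b2M sM.
have M10 : 0 <= M1 := le_trans (normr_ge0 _) fM.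
have M20 : 0 <= M2 := le_trans (normr_ge0 _) gM.
have P (x y : R) u w : `|x| <= M1 * u -> `|y| <= M2 * w -> `|x * y| <= (M1 * M2) * (u * w).
  by move=> xu yw; rewrite normrM mulrACA ler_pM.
have MM0 : 0 <= M1 * M2 by rewrite mulr_ge0.
rewrite -(mulr1 M1) in fM f'M; rewrite -(mulr1 M2) in gM g'M.
have [n1|n1] := leP n 1.
- have -> : f' * g' - f * g - (f * b1 + g * a1) - (f * b2 + g * a2 + a1 * b1) =
    f' * (g' - g - b1 - b2) + (f' - f - a1 - a2) * g + (f' - f - a1 - a2) * b1 +
    (f' - f - a1 - a2) * b2 + a1 * b2 + a2 * b1 + a2 * b2 by ring.
  have n30 : 0 <= n ^+ 3 by rewrite exprn_ge0.
  have T1 := P _ _ _ _ f'M sM; have T2 := P _ _ _ _ rM gM.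
  have T3 := P _ _ _ _ rM b1M; have T4 := P _ _ _ _ rM b2M.
  have T5 := P _ _ _ _ a1M b2M; have T6 := P _ _ _ _ a2M b1M.
  have T7 := P _ _ _ _ a2M b2M.
  have n4 : n ^+ 3 * n <= n ^+ 3 by rewrite ler_piMr.
  have n5 : n ^+ 3 * n ^+ 2 <= n ^+ 3 by rewrite ler_piMr// exprn_ile1.
  have n4' : n ^+ 2 * n ^+ 2 <= n ^+ 3.
    by rewrite (_ : n ^+ 2 * n ^+ 2 = n ^+ 3 * n)//; ring.
  have e1 : n * n ^+ 2 = n ^+ 3 by ring.
  have e2 : n ^+ 2 * n = n ^+ 3 by ring.
  rewrite ?e1 ?e2 ?mul1r ?mulr1 in T1 T2 T3 T4 T5 T6 T7.
  have W (u : R) : u <= n ^+ 3 -> M1 * M2 * u <= M1 * M2 * n ^+ 3.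
    by move=> ?; rewrite ler_wpM2l.
  have {}T3 := le_trans T3 (W _ n4); have {}T4 := le_trans T4 (W _ n5).
  have {}T7 := le_trans T7 (W _ n4').
  by rewrite -mulrA; apply: ler_norm_sum7.
- have T1 := P _ _ _ _ f'M g'M; have T2 := P _ _ _ _ fM gM.
  have T3 := P _ _ _ _ fM b1M; have T4 := P _ _ _ _ a1M gM.
  have T5 := P _ _ _ _ fM b2M; have T6 := P _ _ _ _ a2M gM.
  have T7 := P _ _ _ _ a1M b1M.
  have -> : f' * g' - f * g - (f * b1 + g * a1) - (f * b2 + g * a2 + a1 * b1) =
    f' * g' + (- (f * g)) + (- (f * b1)) + (- (a1 * g)) + (- (f * b2))
      + (- (a2 * g)) + (- (a1 * b1)) by ring.
  rewrite ?mul1r ?mulr1 in T1 T2 T3 T4 T5 T6 T7.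
  have n13 : 1 <= n ^+ 3 by rewrite exprn_ege1// ltW.
  have nn3 : n <= n ^+ 3 by rewrite exprS ler_peMr// exprn_ege1// ltW.
  have n23 : n ^+ 2 <= n ^+ 3 by rewrite [leRHS]exprS ler_peMl ?exprn_ge0// ltW.
  have W (u : R) : u <= n ^+ 3 -> M1 * M2 * u <= M1 * M2 * n ^+ 3.
    by move=> ?; rewrite ler_wpM2l.
  have := W _ n13; rewrite mulr1 => W1; have W2 := W _ nn3; have W3 := W _ n23.
  rewrite -expr2 in T7.
  rewrite -mulrA; apply: ler_norm_sum7; rewrite ?normrN.
  - exact: le_trans T1 W1.
  - exact: le_trans T2 W1.
  - exact: le_trans T3 W2.
  - exact: le_trans T4 W2.
  - exact: le_trans T5 W3.
  - exact: le_trans T6 W3.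
  - exact: le_trans T7 W3.
Qed.

Lemma smooth_mul (R : realType) k (M1 M2 : R) (phi psi : 'cV[R]_k -> R) :
  smooth M1 phi -> smooth M2 psi ->
  smooth (7 * (M1 * M2)) (fun x => phi x * psi x).
Proof.
move=> [G [H hphi]] [G' [H' hpsi]].
exists (fun x a => phi x * G' x a + psi x * G x a).
exists (fun x a b => phi x * H' x a b + psi x * H x a b + G x a * G' x b) => x.
have [fM GM HM rM] := hphi x; have [gM G'M H'M sM] := hpsi x.
have M10 : 0 <= M1 := le_trans (normr_ge0 _) fM.
have M20 : 0 <= M2 := le_trans (normr_ge0 _) gM.
have MM0 : 0 <= M1 * M2 by rewrite mulr_ge0.
have P (y z : R) : `|y| <= M1 -> `|z| <= M2 -> `|y * z| <= M1 * M2.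
  by move=> yu zw; rewrite normrM ler_pM.
have P' (y z : R) : `|y| <= M2 -> `|z| <= M1 -> `|y * z| <= M1 * M2.
  by move=> yu zw; rewrite mulrC P.
split.
- by have := P _ _ fM gM; lra.
- move=> a; have := P _ _ fM (G'M a); have := P' _ _ gM (GM a) => t1 t2.
  by apply: (le_trans (ler_normD _ _)); lra.
- move=> a b; have := P _ _ fM (H'M a b); have := P' _ _ gM (HM a b).
  have := P _ _ (GM a) (G'M b) => t1 t2 t3.
  by move: t1 t2 t3; rewrite !ler_norml; move: (_ * _) (_ * _) (_ * _) => z1 z2 z3; lra.
- move=> v.
  have -> : lin_part (fun a => phi x * G' x a + psi x * G x a) v =
     phi x * lin_part (G' x) v + psi x * lin_part (G x) v.
    rewrite /lin_part !mulr_sumr -big_split; apply: eq_bigr => a _ /=; ring.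
  have -> : quad_part (fun a b => phi x * H' x a b + psi x * H x a b + G x a * G' x b) v =
     phi x * quad_part (H' x) v + psi x * quad_part (H x) v +
     lin_part (G x) v * lin_part (G' x) v.
    rewrite /quad_part /lin_part [X in _ + _ + X]mulr_suml !mulr_sumr -!big_split.
    apply: eq_bigr => a _ /=; rewrite !mulr_sumr -!big_split.
    by apply: eq_bigr => b _ /=; ring.
  apply: mul_remainder_le; rewrite ?norm1_ge0 ?lin_part_le ?quad_part_le//.
    by case: (hphi (x + v)).
  by case: (hpsi (x + v)).
Qed.

Definition smooth_step (R : realType) k (c x : R) (a : 'I_k) (y : 'cV[R]_k) : R :=
  step (c * (y a 0 - x)).

Lemma smooth_smooth_step (R : realType) k (c x : R) (a : 'I_k) :
  0 <= c -> smooth (2 * (1 + c) ^+ 3) (smooth_step c x a).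
Proof.
move=> c0.
exists (fun y b => (b == a)%:R * (c * step1 (c * (y a 0 - x)))).
exists (fun y b b' => ((b == a) && (b' == a))%:R * (c ^+ 2 * step2 (c * (y a 0 - x)))) => y.
have cc1 : 1 <= (1 + c) ^+ 3 by rewrite exprn_ege1//; lra.
have c3 : c <= (1 + c) ^+ 3.
  by apply: (le_trans (_ : _ <= 1 + c)); rewrite ?ler_eXnr//; lra.
have c23 : c ^+ 2 <= (1 + c) ^+ 3.
  apply: (le_trans (_ : _ <= (1 + c) ^+ 2)); first by apply: lerXn2r; rewrite ?nnegrE; lra.
  by apply: ler_weXn2l => //; lra.
have c33 : c ^+ 3 <= (1 + c) ^+ 3 by apply: lerXn2r; rewrite ?nnegrE; lra.
have [s0 s1 s2] := step_bounds (c * (y a 0 - x)).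
have B (b : bool) (u z : R) : 0 <= u -> u <= (1 + c) ^+ 3 -> `|z| <= 2 ->
    `|b%:R * (u * z)| <= 2 * (1 + c) ^+ 3.
  move=> u0 uc z2; rewrite !normrM (ger0_norm u0).
  rewrite [leRHS]mulrC -[leRHS]mul1r ler_pM ?mulr_ge0// ?ler_pM//.
  by case: b; rewrite ?normr1 ?normr0.
split.
- by rewrite /smooth_step ger0_norm; case/andP: s0 => // _; lra.
- by move=> b; exact: B.
- by move=> b b'; apply: B => //; rewrite exprn_ge0.
- move=> v.
  have -> : lin_part (fun b => (b == a)%:R * (c * step1 (c * (y a 0 - x)))) v =
      step1 (c * (y a 0 - x)) * (c * v a 0).
    rewrite /lin_part (bigD1 a)//= eqxx mul1r big1 ?addr0; first by ring.
    by move=> b /negbTE ->; rewrite !mul0r.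
  have -> : quad_part (fun b b' => ((b == a) && (b' == a))%:R *
      (c ^+ 2 * step2 (c * (y a 0 - x)))) v = step2 (c * (y a 0 - x)) * (c * v a 0) ^+ 2.
    rewrite /quad_part (bigD1 a)//= (bigD1 a)//= eqxx /= mul1r.
    rewrite big1 => [|b /negbTE ->]; last by rewrite !mul0r.
    rewrite big1 ?addr0; first by ring.
    by move=> b /negbTE -> /=; apply: big1 => b' _; rewrite !mul0r.
  rewrite /smooth_step mxE.
  rewrite (_ : c * (y a 0 + v a 0 - x) = c * (y a 0 - x) + c * v a 0); last by ring.
  apply: (le_trans (step_taylor _ _)).
  rewrite -mulrA ler_wpM2l// normrM exprMn (ger0_norm c0).
  rewrite ler_pM ?exprn_ge0//; apply: lerXn2r; rewrite ?nnegrE ?norm1_ge0//.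
  exact: ler_norm1.
Qed.

(** All coordinates share the threshold because the target event is that a minimum of linear forms
    exceeds [x]. *)
Definition box_step (R : realType) k (c x : R) (y : 'cV[R]_k) : R :=
  \prod_a smooth_step c x a y.

Lemma smooth_box_step (R : realType) k (c : R) : 0 <= c ->
  exists M : R, 0 <= M /\ forall x, smooth M (@box_step R k c x).
Proof.
move=> c0.
suff [M HM] : exists M : R, forall x, smooth M (fun y => \prod_(a <- index_enum 'I_k) smooth_step c x a y).
  exists M; split; last exact: HM.
  by have [G [H h]] := HM 0; have [+ _ _ _] := h 0; apply: le_trans.
elim: (index_enum _) => [|a s [M IH]].
  exists `|1| => x; rewrite (_ : (fun _ => _) = fun=> 1); first exact: smooth_const.
  by apply/funext => y; rewrite big_nil.
eexists => x.
rewrite (_ : (fun _ => _) =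
   fun y => smooth_step c x a y * \prod_(a <- s) smooth_step c x a y).
  by apply: smooth_mul; [exact: smooth_smooth_step|exact: IH].
by apply/funext => y; rewrite big_cons.
Qed.

Lemma box_step_bounds (R : realType) k (c x : R) (y : 'cV[R]_k) :
  0 <= box_step c x y <= 1.
Proof.
by rewrite prodr_ge0 ?prodr_ile1// => a _; have [] := step_bounds (c * (y a 0 - x)) => // /andP[].
Qed.

Lemma box_step_gt (R : realType) k (c x : R) (y : 'cV[R]_k) :
  0 < c -> box_step c x y <= `[< forall a, x < y a 0 >]%:R.
Proof.
move=> c0; case: asboolP => [_|/existsNP[a /negP]].
  by have /andP[] := box_step_bounds c x y.
rewrite -leNgt => ya; rewrite /box_step (bigD1 a)//= {1}/smooth_step step_le0 ?mul0r//.
by rewrite pmulr_rle0//; lra.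
Qed.

(** The loss [3 * d] is the length of the interval [0, 3] on which [step] rises, rescaled by [d]. *)
Lemma box_step_ge (R : realType) k (d x : R) (y : 'cV[R]_k) :
  0 < d -> `[< forall a, x + 3 * d <= y a 0 >]%:R <= box_step d^-1 x y.
Proof.
move=> d0; case: asboolP => [h|_]; last by have /andP[] := box_step_bounds d^-1 x y.
rewrite /box_step big1// => a _; rewrite /smooth_step step_ge3// mulrC.
by rewrite ler_pdivlMr//; have := h a; lra.
Qed.

(** * Lindeberg replacement *)

(** Functionals on all functions, without integrability or measurability side conditions; the laws
    used below are finite averages, for which this costs nothing. *)
Definition expectation (R : realType) (W : Type) (E : (W -> R) -> R) : Prop :=
  [/\ forall c F G, E (fun v => c * F v + G v) = c * E F + E G,
      forall F G, (forall v, F v <= G v) -> E F <= E G &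
      E (fun=> 1) = 1].

Section expectation_theory.
Context (R : realType) (W : Type) (E : (W -> R) -> R).
Hypothesis hE : expectation E.

Lemma exp_lin c F G : E (fun v => c * F v + G v) = c * E F + E G.
Proof. by case: hE. Qed.

Lemma exp_le F G : (forall v, F v <= G v) -> E F <= E G.
Proof. by case: hE => _ + _; exact. Qed.

Lemma exp0 : E (fun=> 0) = 0.
Proof.
have e : E (fun v => - 1 * 1 + 1) = 0 by rewrite exp_lin mulN1r addNr.
by rewrite -[RHS]e; congr E; apply/funext => v; rewrite mulN1r addNr.
Qed.

Lemma expM c F : E (fun v => c * F v) = c * E F.
Proof.
rewrite -[RHS]addr0 -exp0 -exp_lin; congr E.
by apply/funext => v; rewrite addr0.
Qed.

Lemma expMr c F : E (fun v => F v * c) = E F * c.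
Proof. by rewrite mulrC -expM; congr E; apply/funext => v; rewrite mulrC. Qed.

Lemma expD F G : E (fun v => F v + G v) = E F + E G.
Proof. by rewrite -[E F]mul1r -exp_lin; congr E; apply/funext => v; rewrite mul1r. Qed.

Lemma expN F : E (fun v => - F v) = - E F.
Proof. by rewrite -mulN1r -expM; congr E; apply/funext => v; rewrite mulN1r. Qed.

Lemma expB F G : E (fun v => F v - G v) = E F - E G.
Proof. by rewrite expD expN. Qed.

Lemma exp_cst c : E (fun=> c) = c.
Proof.
case: hE => _ _ h; rewrite -[RHS]mulr1 -h -expM; congr E.
by apply/funext => v; rewrite mulr1.
Qed.

Lemma exp_sum I (r : seq I) (F : I -> W -> R) :
  E (fun v => \sum_(i <- r) F i v) = \sum_(i <- r) E (F i).
Proof.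
elim: r => [|i r IH].
  by rewrite big_nil -[RHS]exp0; congr E; apply/funext => v; rewrite big_nil.
by rewrite big_cons -IH -expD; congr E; apply/funext => v; rewrite big_cons.
Qed.

Lemma exp_norm_le F B : (forall v, `|F v| <= B v) -> `|E F| <= E B.
Proof.
move=> h; rewrite ler_norml -expN; apply/andP; split; apply: exp_le => v;
  by have := h v; rewrite ler_norml => /andP[].
Qed.

Lemma exp_ge0 F : (forall v, 0 <= F v) -> 0 <= E F.
Proof. by move=> h; rewrite -exp0; exact: exp_le. Qed.

Lemma exp_sqr_le F : E F ^+ 2 <= E (fun v => F v ^+ 2).
Proof.
have : 0 <= E (fun v => (F v - E F) ^+ 2) by apply: exp_ge0 => v; exact: sqr_ge0.
rewrite (_ : (fun v => _) = (fun v => F v ^+ 2 + ((- 2 * E F) * F v + E F ^+ 2))); last first.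
  by apply/funext => v; ring.
rewrite expD expD expM exp_cst; nra.
Qed.

Lemma exp_poly4 (F : W -> R) c0 c1 c2 c3 c4 :
  E (fun v => c0 + c1 * F v + c2 * F v ^+ 2 + c3 * F v ^+ 3 + c4 * F v ^+ 4) =
  c0 + c1 * E F + c2 * E (fun v => F v ^+ 2) + c3 * E (fun v => F v ^+ 3) +
  c4 * E (fun v => F v ^+ 4).
Proof. by rewrite !expD !expM exp_cst. Qed.

End expectation_theory.

(** Averaging over one random step started at [x]; the n-th iterate is the expectation after n
    independent steps. *)
Definition cvl (R : realType) k (E : ('cV[R]_k -> R) -> R) (phi : 'cV[R]_k -> R)
    (x : 'cV[R]_k) : R := E (fun v => phi (x + v)).

Section convolution.
Context (R : realType) (k : nat).
Implicit Types (E : ('cV[R]_k -> R) -> R) (phi : 'cV[R]_k -> R) (x : 'cV[R]_k).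

Lemma expectation_cvl E x : expectation E -> expectation (fun phi => cvl E phi x).
Proof.
move=> hE; split.
- by move=> c F G; rewrite /cvl exp_lin.
- by move=> F G FG; rewrite /cvl; apply: exp_le.
- by rewrite /cvl exp_cst.
Qed.

Lemma expectation_iter_cvl E n x :
  expectation E -> expectation (fun phi => iter n (cvl E) phi x).
Proof.
move=> hE; elim: n x => [|n IH] x; first by split => //= F G.
split => /=.
- move=> c F G; rewrite -(exp_lin (expectation_cvl x hE)); congr (cvl E _ x).
  by apply/funext => y; rewrite (exp_lin (IH y)).
- move=> F G FG; apply: (exp_le (expectation_cvl x hE)) => y.
  exact: (exp_le (IH y)).
- rewrite (_ : iter n (cvl E) _ = fun=> 1); first exact: (exp_cst (expectation_cvl x hE)).
  by apply/funext => y; rewrite (exp_cst (IH y)).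
Qed.

Lemma iter_cvl_shift E n phi x y :
  iter n (cvl E) (fun v => phi (y + v)) x = iter n (cvl E) phi (y + x).
Proof.
elim: n x => //= n IH x; rewrite /cvl; congr E; apply/funext => v.
by rewrite -addrA; exact: IH.
Qed.

(** Since [cvl E] commutes with translations, m steps started at x act like one step drawn from the
    law of m steps started at 0. *)
Lemma iter_cvl_block E n m phi :
  iter (n * m) (cvl E) phi = iter n (cvl (fun psi => iter m (cvl E) psi 0)) phi.
Proof.
elim: n => //= n IH; rewrite mulSn iterD IH.
apply/funext => x; rewrite -[x in LHS]addr0; apply/esym.
exact: (iter_cvl_shift E m (iter n _ phi) 0 x).
Qed.

(** Averaging the Taylor coefficients keeps all four bounds. That [M] does not grow is what allows
    an unlimited number of replacements. *)
Lemma smooth_cvl E M phi : expectation E -> smooth M phi -> smooth M (cvl E phi).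
Proof.
move=> hE [G [H h]].
exists (fun x a => E (fun v => G (x + v) a)), (fun x a b => E (fun v => H (x + v) a b)) => x.
have bd (F : 'cV[R]_k -> R) : (forall v, `|F v| <= M) -> `|E F| <= M.
  by move=> FM; rewrite -[leRHS](exp_cst hE); exact: exp_norm_le.
split.
- by apply: bd => v; case: (h (x + v)).
- by move=> a; apply: bd => v; case: (h (x + v)).
- by move=> a b; apply: bd => v; case: (h (x + v)).
- move=> u; rewrite /cvl.
  have -> : lin_part (fun a => E (fun v => G (x + v) a)) u =
      E (fun v => lin_part (G (x + v)) u).
    rewrite /lin_part (exp_sum hE); apply: eq_bigr => a _.
    by rewrite (expMr hE).
  have -> : quad_part (fun a b => E (fun v => H (x + v) a b)) u =
      E (fun v => quad_part (H (x + v)) u).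
    rewrite /quad_part (exp_sum hE); apply: eq_bigr => a _.
    rewrite (exp_sum hE); apply: eq_bigr => b _.
    by rewrite (expMr hE).
  rewrite -!(expB hE); apply: (le_trans (exp_norm_le hE (B := fun=> M * norm1 u ^+ 3) _)).
    by move=> v; rewrite (addrAC x u v); case: (h (x + v)).
  by rewrite (exp_cst hE).
Qed.

(** Steps are exchanged one at a time. The steps already replaced only smooth the test function
    further, and the steps still to be replaced act on the outside as a contraction, so the errors
    add without amplification. *)
Lemma lindeberg E E' M e :
  expectation E -> expectation E' ->
  (forall psi, smooth M psi -> forall x, `|cvl E psi x - cvl E' psi x| <= e) ->
  forall phi, smooth M phi -> forall n x,
  `|iter n (cvl E) phi x - iter n (cvl E') phi x| <= n%:R * e.
Proof.
move=> hE hE' hEE' phi sphi n.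
have sm j : smooth M (iter j (cvl E') phi).
  by elim: j => // j IH; exact: smooth_cvl.
elim: n => [|n IH] x /=; first by rewrite subrr normr0 mul0r.
rewrite -(subrKA (cvl E (iter n (cvl E') phi) x)).
rewrite -natr1 mulrDl mul1r; apply: (le_trans (ler_normD _ _)); apply: lerD.
  rewrite -(expB (expectation_cvl x hE)).
  rewrite -[leRHS](exp_cst (expectation_cvl x hE)).
  by apply: (exp_norm_le (expectation_cvl x hE)).
exact: hEE'.
Qed.

End convolution.

(** * Moments of steps and comparison of normalized sums *)

Lemma sqr_sum_le (R : realType) k (x : 'I_k -> R) :
  (\sum_a x a) ^+ 2 <= k%:R * \sum_a x a ^+ 2.
Proof.
have : 0 <= \sum_a \sum_b (x a - x b) ^+ 2.
  by apply: sumr_ge0 => a _; apply: sumr_ge0 => b _; exact: sqr_ge0.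
have -> : \sum_a \sum_b (x a - x b) ^+ 2 =
    \sum_(a < k) \sum_(b < k) x a ^+ 2 + \sum_(a < k) \sum_b x b ^+ 2
    - 2 * \sum_a \sum_b x a * x b.
  rewrite mulr_sumr -sumrN -!big_split; apply: eq_bigr => a _ /=.
  rewrite mulr_sumr -sumrN -!big_split; apply: eq_bigr => b _ /=; ring.
have -> : \sum_a \sum_b x a * x b = (\sum_a x a) ^+ 2.
  by rewrite expr2 mulr_suml; apply: eq_bigr => a _; rewrite mulr_sumr.
have -> : \sum_(a < k) \sum_(b < k) x a ^+ 2 = k%:R * \sum_a x a ^+ 2.
  by rewrite mulr_sumr; apply: eq_bigr => a _; rewrite sumr_const card_ord mulr_natl.
rewrite [X in _ + X - _]sumr_const card_ord -[X in _ + X - _]mulr_natl.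
lra.
Qed.

(** A centred step of scale [s]. Fourth moments are recorded instead of the third absolute moments
    that the remainder needs, because they are polynomial and so can be computed exactly along
    sums. *)
Definition law (R : realType) k (s : R) (Gam : 'I_k -> 'I_k -> R) (Q : R)
    (E : ('cV[R]_k -> R) -> R) : Prop :=
  [/\ expectation E, forall a, E (fun v => v a 0) = 0,
      forall a b, E (fun v => v a 0 * v b 0) = s ^+ 2 * Gam a b &
      forall a, E (fun v => v a 0 ^+ 4) <= s ^+ 4 * Q].

(** The first summand comes from the second moment of the norm, the second from its fourth moment,
    as combined in [law_third]. *)
Definition third_bound (R : realType) (k : nat) (Q : R) : R :=
  k%:R ^+ 2 * (1 + Q) + k%:R ^+ 4 * Q.

Section law_theory.
Context (R : realType) (k : nat).
Implicit Types (E : ('cV[R]_k -> R) -> R) (Gam : 'I_k -> 'I_k -> R) (Q s : R).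

(** The odd power is traded for even ones at the scale of the step, by z^3 <= s z^2 + z^4/s and z^2
    <= s^2 + z^4/s^2; every term is then a multiple of s^3. *)
Lemma law_third s Gam Q E : 0 < s -> law s Gam Q E ->
  E (fun v => norm1 v ^+ 3) <= s ^+ 3 * third_bound k Q.
Proof.
move=> s0 [hE _ _ h4].
have n2 (v : 'cV[R]_k) : norm1 v ^+ 2 <= k%:R * \sum_a v a 0 ^+ 2.
  apply: (le_trans (sqr_sum_le _)); rewrite ler_wpM2l//.
  by apply: ler_sum => a _; rewrite real_normK ?num_real.
have n4 (v : 'cV[R]_k) : norm1 v ^+ 4 <= k%:R ^+ 3 * \sum_a v a 0 ^+ 4.
  rewrite (_ : 4%N = (2 * 2)%N)// exprM.
  apply: (le_trans (_ : _ <= (k%:R * \sum_a v a 0 ^+ 2) ^+ 2)).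
    by apply: lerXn2r; rewrite ?nnegrE ?exprn_ge0 ?mulr_ge0 ?norm1_ge0 ?sumr_ge0// => a _; exact: sqr_ge0.
  rewrite exprMn; apply: (le_trans (ler_wpM2l _ (sqr_sum_le _))); first exact: sqr_ge0.
  rewrite mulrA -exprSr ler_wpM2l ?exprn_ge0//.
  by apply: ler_sum => a _; rewrite -exprM.
have v2 (z : R) : z ^+ 2 <= s ^+ 2 + s ^- 2 * z ^+ 4.
  have -> : z ^+ 2 = s ^+ 2 * (z / s) ^+ 2 by field; lra.
  have -> : s ^- 2 * z ^+ 4 = s ^+ 2 * (z / s) ^+ 4 by field; lra.
  rewrite -[X in _ <= X + _]mulr1 -mulrDr ler_wpM2l ?sqr_ge0//.
  by have := sqr_ge0 ((z / s) ^+ 2 - 1); nra.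
have n3 (v : 'cV[R]_k) : norm1 v ^+ 3 <= s * norm1 v ^+ 2 + s^-1 * norm1 v ^+ 4.
  set z := norm1 v.
  have -> : s * z ^+ 2 + s^-1 * z ^+ 4 = z ^+ 3 + s^-1 * z ^+ 2 * (s ^+ 2 - s * z + z ^+ 2).
    by field; lra.
  have zs : 0 <= s ^+ 2 - s * z + z ^+ 2.
    by have := sqr_ge0 (s - z); have := sqr_ge0 s; have := sqr_ge0 z; nra.
  by rewrite lerDl mulr_ge0// mulr_ge0 ?invr_ge0 ?sqr_ge0 ?(ltW s0).
pose B (v : 'cV[R]_k) := s * (k%:R * \sum_a (s ^+ 2 + s ^- 2 * v a 0 ^+ 4)) +
   s^-1 * (k%:R ^+ 3 * \sum_a v a 0 ^+ 4).
apply: (le_trans (exp_le hE (G := B) _)).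
  move=> v; apply: (le_trans (n3 v)); apply: lerD.
    rewrite ler_wpM2l ?(ltW s0)//; apply: (le_trans (n2 v)); rewrite ler_wpM2l//.
    by apply: ler_sum => a _.
  by rewrite ler_wpM2l ?invr_ge0 ?(ltW s0).
have h (c : R) (r : 'I_k -> R) : (forall a, r a <= c) -> \sum_a r a <= k%:R * c.
  by move=> rc; rewrite -[k in leRHS]card_ord mulr_natl -sumr_const; apply: ler_sum.
have s0' := ltW s0.
rewrite /B (expD hE) (expM hE) (expM hE) (exp_sum hE) (expM hE) (expM hE) (exp_sum hE).
apply: (le_trans (_ : _ <= s * (k%:R * (k%:R * (s ^+ 2 + s ^- 2 * (s ^+ 4 * Q)))) +
   s^-1 * (k%:R ^+ 3 * (k%:R * (s ^+ 4 * Q))))).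
  apply: lerD.
    rewrite !ler_wpM2l//; apply: h => a; rewrite (expD hE) (exp_cst hE) (expM hE).
    by rewrite lerD2l ler_wpM2l// invr_ge0 sqr_ge0.
  by rewrite !ler_wpM2l ?invr_ge0 ?exprn_ge0//; exact: h.
rewrite le_eqVlt; apply/orP; left; apply/eqP; rewrite /third_bound; field; lra.
Qed.

(** After a second-order expansion the centring kills the linear part, the quadratic parts differ by
    the covariance gap, and each remainder is bounded by a third moment. *)
Lemma law_compare s Gam Gam' Q kap E E' M psi x : 0 < s ->
  law s Gam Q E -> law s Gam' Q E' ->
  (forall a b, `|Gam a b - Gam' a b| <= kap) -> smooth M psi ->
  `|cvl E psi x - cvl E' psi x| <=
    M * (k%:R ^+ 2 * kap * s ^+ 2 + 2 * third_bound k Q * s ^+ 3).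
Proof.
move=> s0 lE lE' hk [G [H h]]; have [psiM _ HM rem] := h x.
have M0 : 0 <= M := le_trans (normr_ge0 _) psiM.
have expand E0 Gam0 : law s Gam0 Q E0 ->
    `|cvl E0 psi x - psi x - s ^+ 2 * \sum_a \sum_b H x a b * Gam0 a b| <=
      M * (third_bound k Q * s ^+ 3).
  move=> lE0; have [hE0 m1 m2 _] := lE0.
  have -> : cvl E0 psi x - psi x - s ^+ 2 * \sum_a \sum_b H x a b * Gam0 a b =
    E0 (fun v => psi (x + v) - psi x - lin_part (G x) v - quad_part (H x) v).
    rewrite !(expB hE0) (exp_cst hE0) /lin_part (exp_sum hE0).
    rewrite [X in _ = _ - X - _]big1 ?subr0 => [|a _]; last by rewrite (expM hE0) m1 mulr0.
    congr (_ - _); rewrite /quad_part (exp_sum hE0) mulr_sumr; apply: eq_bigr => a _.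
    rewrite (exp_sum hE0) mulr_sumr; apply: eq_bigr => b _.
    by rewrite (expM hE0) m2; ring.
  apply: (le_trans (exp_norm_le hE0 rem)); rewrite (expM hE0) ler_wpM2l//.
  by rewrite mulrC; exact: law_third lE0.
have d : `|\sum_a \sum_b H x a b * Gam a b - \sum_a \sum_b H x a b * Gam' a b| <=
   M * (k%:R ^+ 2 * kap).
  have -> : M * (k%:R ^+ 2 * kap) = \sum_(a < k) \sum_(b < k) M * kap.
    by rewrite !sumr_const !card_ord -mulrnA -[_ *+ (k * k)]mulr_natl natrM; ring.
  rewrite -sumrB (le_trans (ler_norm_sum _ _ _))//; apply: ler_sum => a _.
  rewrite -sumrB (le_trans (ler_norm_sum _ _ _))//; apply: ler_sum => b _.
  by rewrite -mulrBr normrM ler_pM.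
have := expand _ _ lE; have := expand _ _ lE'.
move: d; set S := \sum_a _; set S' := \sum_a _ => d.
have {}d : `|s ^+ 2 * S - s ^+ 2 * S'| <= M * (k%:R ^+ 2 * kap * s ^+ 2).
  by rewrite -mulrBr normrM ger0_norm ?sqr_ge0// [leRHS]mulrA [leLHS]mulrC ler_wpM2r ?sqr_ge0.
move: d; move: (s ^+ 2 * S) (s ^+ 2 * S') => u u'; rewrite mulrDr !ler_norml.
by move=> /andP[? ?] /andP[? ?] /andP[? ?]; apply/andP; split; lra.
Qed.

Lemma law_le_fourth s Gam Q Q' E : Q <= Q' -> law s Gam Q E -> law s Gam Q' E.
Proof.
move=> QQ' [hE h1 h2 h4]; split => // a; apply: (le_trans (h4 a)).
by rewrite ler_wpM2l// (_ : s ^+ 4 = (s ^+ 2) ^+ 2) ?sqr_ge0// -exprM.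
Qed.

Definition block_law E m (phi : 'cV[R]_k -> R) : R := iter m (cvl E) phi 0.

(** Centred independent steps give fourth moment m g4 + 3 m (m - 1) g2^2, and g2^2 <= g4, so the
    factor 4 is ample. Each moment is computed from an arbitrary starting point, since the induction
    on the number of steps moves it. *)
Lemma law_block s Gam Q E m : 0 <= Q -> law s Gam Q E ->
  law (s * Num.sqrt m%:R) Gam (4 * Q) (block_law E m).
Proof.
move=> Q0 [hE m1 m2 m4].
have hB := expectation_iter_cvl m 0 hE.
have s2 : Num.sqrt m%:R ^+ 2 = m%:R :> R by rewrite sqr_sqrtr.
split => //.
- move=> a; rewrite /block_law.
  suff -> : iter m (cvl E) (fun v => v a 0) = fun x => x a 0 by rewrite mxE.
  elim: m {hB s2} => //= m ->; apply/funext => x; rewrite /cvl.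
  rewrite (_ : (fun v => _) = fun v : 'cV[R]_k => x a 0 + v a 0); last by apply/funext => v; rewrite mxE.
  by rewrite (expD hE) (exp_cst hE) m1 addr0.
- move=> a b; rewrite /block_law exprMn s2.
  suff -> : iter m (cvl E) (fun v => v a 0 * v b 0) =
      fun x => x a 0 * x b 0 + m%:R * (s ^+ 2 * Gam a b).
    by rewrite !mxE mul0r add0r mulrCA mulrA.
  elim: m {hB s2} => [|m /= ->]; first by apply/funext => x; rewrite mul0r addr0.
  apply/funext => x; rewrite /cvl.
  rewrite (_ : (fun v => _) = fun v : 'cV[R]_k =>
      (x a 0 * x b 0 + m%:R * (s ^+ 2 * Gam a b)) +
      (x a 0 * v b 0 + (x b 0 * v a 0 + v a 0 * v b 0))); last first.
    by apply/funext => v; rewrite !mxE; ring.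
  by rewrite !(expD hE) !(exp_cst hE) !(expM hE) !m1 m2 -natr1; ring.
- move=> a; rewrite /block_law.
  pose g2 := E (fun v => v a 0 ^+ 2).
  pose g3 := E (fun v => v a 0 ^+ 3).
  pose g4 := E (fun v => v a 0 ^+ 4).
  have g22 : g2 ^+ 2 <= g4.
    apply: (le_trans (exp_sqr_le hE _)).
    by rewrite /g4; apply: exp_le => // v; rewrite -exprM.
  have -> : iter m (cvl E) (fun v => v a 0 ^+ 4) = fun x =>
      x a 0 ^+ 4 + 6 * m%:R * g2 * x a 0 ^+ 2 + 4 * m%:R * g3 * x a 0 +
      (m%:R * g4 + 3 * m%:R * (m%:R - 1) * g2 ^+ 2).
    elim: m {hB s2} => [|m /= ->]; first by apply/funext => x; rewrite /= !(mulr0, mul0r, addr0).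
    apply/funext => x; rewrite /cvl.
    rewrite (_ : (fun v => _) = fun v : 'cV[R]_k =>
        (x a 0 ^+ 4 + 6 * m%:R * g2 * x a 0 ^+ 2 + 4 * m%:R * g3 * x a 0 +
         (m%:R * g4 + 3 * m%:R * (m%:R - 1) * g2 ^+ 2)) +
        (4 * x a 0 ^+ 3 + 12 * m%:R * g2 * x a 0 + 4 * m%:R * g3) * v a 0 +
        (6 * x a 0 ^+ 2 + 6 * m%:R * g2) * v a 0 ^+ 2 + (4 * x a 0) * v a 0 ^+ 3 +
        1 * v a 0 ^+ 4); last by apply/funext => v; rewrite !mxE; ring.
    rewrite (exp_poly4 hE (fun v => v a 0)) m1 -/g2 -/g3 -/g4 -natr1; ring.
  rewrite !mxE expr0n /= !(mulr0, add0r).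
  have -> : (s * Num.sqrt m%:R) ^+ 4 * (4 * Q) = 4 * m%:R ^+ 2 * (s ^+ 4 * Q).
    by rewrite exprMn (exprM (Num.sqrt _) 2 2) s2; ring.
  have g40 : g4 <= s ^+ 4 * Q by exact: m4.
  have g20 : 0 <= g2 ^+ 2 := sqr_ge0 _.
  case: m {hB s2} => [|m]; first by rewrite !(mulr0n, mul0r, mulr0, expr0n, addr0)/=.
  have m0 : 0 <= m%:R :> R by rewrite ler0n.
  rewrite -natr1; nra.
Qed.

Definition scale_law s E (phi : 'cV[R]_k -> R) : R := E (fun v => phi (s *: v)).

Lemma law_scale s Gam Q E : law 1 Gam Q E -> law s Gam Q (scale_law s E).
Proof.
move=> [hE m1 m2 m4]; split.
- split.
  + by move=> c F G; rewrite /scale_law (exp_lin hE).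
  + by move=> F G FG; apply: (exp_le hE).
  + exact: (exp_cst hE).
- move=> a; rewrite /scale_law (_ : (fun v => _) = (fun v : 'cV[R]_k => s * v a 0)).
    by rewrite (expM hE) m1 mulr0.
  by apply/funext => v; rewrite mxE.
- move=> a b; rewrite /scale_law.
  rewrite (_ : (fun v => _) = (fun v : 'cV[R]_k => s ^+ 2 * (v a 0 * v b 0))).
    by rewrite (expM hE) m2; ring.
  by apply/funext => v; rewrite !mxE; ring.
- move=> a; rewrite /scale_law.
  rewrite (_ : (fun v => _) = (fun v : 'cV[R]_k => s ^+ 4 * (v a 0 ^+ 4))).
    rewrite (expM hE) ler_wpM2l ?real_exprn_even_ge0 ?num_real//.
    by have := m4 a; rewrite expr1n mul1r.
  by apply/funext => v; rewrite !mxE exprMn.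
Qed.

Definition normalized_sum n E (phi : 'cV[R]_k -> R) : R :=
  iter n (cvl (scale_law (Num.sqrt n%:R)^-1 E)) phi 0.

Lemma expectation_normalized_sum n E Gam Q : law 1 Gam Q E ->
  expectation (normalized_sum n E).
Proof.
by move=> lE; apply: expectation_iter_cvl; have [] := law_scale (Num.sqrt n%:R)^-1 lE.
Qed.

(* Both sums are compared with n m steps of size 1/sqrt(n m), grouped into n
   blocks on one side and into m blocks on the other. *)
Lemma normalized_sum_compare M Gam Gam' Q kap E E' n m phi :
  (0 < n)%N -> (0 < m)%N -> 0 <= Q ->
  law 1 Gam Q E -> law 1 Gam' Q E' ->
  (forall a b, `|Gam a b - Gam' a b| <= kap) -> smooth M phi ->
  `|normalized_sum n E phi - normalized_sum m E' phi| <=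
    M * (k%:R ^+ 2 * kap + 6 * third_bound k (4 * Q) *
      ((Num.sqrt n%:R)^-1 + (Num.sqrt m%:R)^-1)).
Proof.
move=> n0 m0 Q0 lE lE' hk sphi.
have Q4 : Q <= 4 * Q by lra.
have M0 : 0 <= M.
  by case: (sphi) => G [H /(_ 0)[+ _ _ _]]; apply: le_trans.
have nr (j : nat) : (0 < j)%N -> 0 < Num.sqrt j%:R :> R.
  by move=> j0; rewrite sqrtr_gt0 ltr0n.
have s2 (j : nat) : (0 < j)%N -> j%:R * (Num.sqrt j%:R)^-1 ^+ 2 = 1 :> R.
  by move=> j0; rewrite exprVn sqr_sqrtr// mulfV// pnatr_eq0 -lt0n.
have s3 (j : nat) : (0 < j)%N ->
   j%:R * (Num.sqrt j%:R)^-1 ^+ 3 = (Num.sqrt j%:R)^-1 :> R.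
  by move=> j0; rewrite exprSr mulrA s2// mul1r.
have same E0 Gam0 i j : (0 < i)%N -> (0 < j)%N -> law 1 Gam0 Q E0 ->
    `|normalized_sum i E0 phi -
      iter (i * j) (cvl (scale_law (Num.sqrt (i * j)%:R)^-1 E0)) phi 0| <=
    M * (2 * third_bound k (4 * Q) * (Num.sqrt i%:R)^-1).
  move=> i0 j0 lE0; rewrite iter_cvl_block /normalized_sum.
  have l1 := law_le_fourth Q4 (law_scale (Num.sqrt i%:R)^-1 lE0).
  have := law_block j Q0 (law_scale (Num.sqrt (i * j)%:R)^-1 lE0).
  have -> : (Num.sqrt (i * j)%:R)^-1 * Num.sqrt j%:R = (Num.sqrt i%:R)^-1 :> R.
    by rewrite natrM sqrtrM// invfM -mulrA mulVf ?mulr1// gt_eqF ?nr.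
  move=> l2.
  have si : 0 < (Num.sqrt i%:R)^-1 :> R by rewrite invr_gt0 nr.
  (* The block of [j] small steps has the same covariance as one step of scale 1/sqrt i, so the gap
     is 0 and only the third-order term remains: i errors of order i^(-3/2). *)
  have hk0 a b : `|Gam0 a b - Gam0 a b| <= 0 by rewrite subrr normr0.
  have [h1 _ _ _] := l1; have [h2 _ _ _] := l2.
  apply: (le_trans (lindeberg h1 h2 (fun psi sp x => law_compare x si l1 l2 hk0 sp) sphi i 0)).
  by rewrite mulr0 mul0r add0r mulrCA ler_wpM2l// mulrCA s3.
have d1 := same _ _ n m n0 m0 lE.
have d2 := same _ _ m n m0 n0 lE.
(* The law is changed at [m] steps, so only sums of [E] are regrouped. The errors total 2/sqrt n +
   4/sqrt m times the same factor, whence the constant 6. *)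
have d3 : `|normalized_sum m E phi - normalized_sum m E' phi| <=
    M * (k%:R ^+ 2 * kap + 2 * third_bound k (4 * Q) * (Num.sqrt m%:R)^-1).
  have l1 := law_le_fourth Q4 (law_scale (Num.sqrt m%:R)^-1 lE).
  have l2 := law_le_fourth Q4 (law_scale (Num.sqrt m%:R)^-1 lE').
  have si : 0 < (Num.sqrt m%:R)^-1 :> R by rewrite invr_gt0 nr.
  have [h1 _ _ _] := l1; have [h2 _ _ _] := l2.
  apply: (le_trans (lindeberg h1 h2 (fun psi sp x => law_compare x si l1 l2 hk sp) sphi m 0)).
  rewrite mulrCA ler_wpM2l// mulrDr [X in X + _]mulrCA s2// mulr1.
  by rewrite [X in _ + X]mulrCA s3.
have T0 : 0 <= third_bound k (4 * Q).
  by rewrite /third_bound addr_ge0// mulr_ge0 ?exprn_ge0//; lra.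
have W (j : nat) : 0 <= M * (third_bound k (4 * Q) * (Num.sqrt j%:R)^-1).
  by rewrite !mulr_ge0// invr_ge0 sqrtr_ge0.
rewrite mulnC in d2.
have := W n; have := W m; move: d1 d2 d3.
rewrite !ler_norml.
move: (iter _ _ _ _) (normalized_sum _ _ _) (normalized_sum _ _ _) => z z1 z2.
move: (normalized_sum _ _ _) (third_bound _ _) => z3 t.
by move=> /andP[? ?] /andP[? ?] /andP[? ?] ? ?; apply/andP; split; lra.
Qed.

End law_theory.

(** * Anticoncentration *)

Definition prob (R : realType) (W : Type) (E : (W -> R) -> R) (S : set W) : R :=
  E (fun v => `[< S v >]%:R).

Section prob_theory.
Context (R : realType) (W : Type) (E : (W -> R) -> R).
Hypothesis hE : expectation E.

Lemma prob_le (S S' : set W) : S `<=` S' -> prob E S <= prob E S'.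
Proof.
move=> SS'; apply: (exp_le hE) => v; rewrite ler_nat.
by case: asboolP => // /SS' ?; rewrite asboolT.
Qed.

Lemma probC (S : set W) : prob E (~` S) = 1 - prob E S.
Proof.
rewrite /prob -[X in X - _](exp_cst hE) -(expB hE); congr E.
by apply/funext => v; rewrite asbool_neg; case: asbool; rewrite /= ?subrr ?subr0.
Qed.

Lemma prob_setU (S S' : set W) : prob E (S `|` S') <= prob E S + prob E S'.
Proof.
rewrite /prob -(expD hE); apply: (exp_le hE) => v; rewrite -natrD ler_nat asbool_or.
by do 2 case: asbool.
Qed.

Lemma prob_bigcup (I : finType) (S : I -> set W) :
  prob E [set v | exists i, S i v] <= \sum_i prob E (S i).
Proof.
rewrite /prob -(exp_sum hE); apply: (exp_le hE) => v.
case: asboolP => [[i Si]|_]; last exact: sumr_ge0.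
by rewrite (bigD1 i)//= asboolT// lerDl sumr_ge0.
Qed.

Lemma markov_prob (F : W -> R) (t : R) : 0 < t -> (forall v, 0 <= F v) ->
  prob E [set v | t <= F v] <= E F / t.
Proof.
move=> t0 F0; rewrite /prob -(expMr hE); apply: (exp_le hE) => v.
case: asboolP => [/= tF|_]; last by rewrite divr_ge0// ltW.
by rewrite ler_pdivlMr// mul1r.
Qed.

End prob_theory.

Lemma third_bound_ge0 (R : realType) k (Q : R) : 0 <= Q -> 0 <= third_bound k Q.
Proof.
by move=> Q0; rewrite /third_bound addr_ge0// mulr_ge0 ?exprn_ge0//; lra.
Qed.

(** [B] depends only on the dimension, [d] and [Q]; this uniformity allows a random threshold and
    random multinomial parameters later. The smoothed box lies between the two indicators. *)
Lemma prob_box_compare (R : realType) k (d Q : R) : 0 < d -> 0 <= Q ->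
  exists2 B : R, 0 <= B & forall E E' (Gam Gam' : 'I_k -> 'I_k -> R) (kap : R) n m (x : R),
  (0 < n)%N -> (0 < m)%N -> 0 <= kap ->
  law 1 Gam Q E -> law 1 Gam' Q E' ->
  (forall a b, `|Gam a b - Gam' a b| <= kap) ->
  prob (normalized_sum n E) [set v | forall a, x + 3 * d <= v a 0] <=
  prob (normalized_sum m E') [set v | forall a, x < v a 0] +
  B * (kap + (Num.sqrt n%:R)^-1 + (Num.sqrt m%:R)^-1).
Proof.
move=> d0 Q0; have di0 : 0 < d^-1 by rewrite invr_gt0.
have [M [M0 sM]] := @smooth_box_step R k d^-1 (ltW di0).
pose t := third_bound k (4 * Q); have t0 : 0 <= t by apply: third_bound_ge0; lra.
exists (M * (k%:R ^+ 2 + 6 * t)).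
  by rewrite mulr_ge0// addr_ge0 ?mulr_ge0// exprn_ge0.
move=> E E' Gam Gam' kap n m x n0 m0 kap0 lE lE' hk.
have hn := expectation_normalized_sum n lE.
have hm := expectation_normalized_sum m lE'.
have := normalized_sum_compare n0 m0 Q0 lE lE' hk (sM x).
rewrite ler_norml => /andP[_ h].
have h1 : prob (normalized_sum n E) [set v | forall a, x + 3 * d <= v a 0] <=
    normalized_sum n E (box_step d^-1 x).
  by apply: (exp_le hn) => v; exact: box_step_ge.
have h2 : normalized_sum m E' (box_step d^-1 x) <=
    prob (normalized_sum m E') [set v | forall a, x < v a 0].
  by apply: (exp_le hm) => v; exact: box_step_gt.
suff : M * (k%:R ^+ 2 * kap + 6 * t * ((Num.sqrt n%:R)^-1 + (Num.sqrt m%:R)^-1)) <=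
    M * (k%:R ^+ 2 + 6 * t) * (kap + (Num.sqrt n%:R)^-1 + (Num.sqrt m%:R)^-1).
  by move: h h1 h2; rewrite -/t; lra.
rewrite -[leRHS]mulrA ler_wpM2l//.
set sn := (Num.sqrt n%:R)^-1; set sm := (Num.sqrt m%:R)^-1.
have sn0 : 0 <= sn by rewrite invr_ge0 sqrtr_ge0.
have sm0 : 0 <= sm by rewrite invr_ge0 sqrtr_ge0.
have k20 : 0 <= k%:R ^+ 2 :> R by rewrite exprn_ge0.
have := mulr_ge0 k20 (addr_ge0 sn0 sm0); have := mulr_ge0 t0 kap0; nra.
Qed.

(** * Rademacher sums and binomial coefficients *)

Definition rademacher (R : realType) (c : R) (phi : 'cV[R]_1 -> R) : R :=
  (phi (const_mx c) + phi (const_mx (- c))) / 2.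

Lemma law_rademacher (R : realType) (c : R) :
  law 1 (fun _ _ => c ^+ 2) (c ^+ 4) (rademacher c).
Proof.
rewrite /rademacher; split.
- split.
  + by move=> a F G; field.
  + by move=> F G FG; rewrite ler_pM2r ?invr_gt0// lerD.
  + by field.
- by move=> a; rewrite !mxE; field.
- by move=> a b; rewrite !mxE; field.
- by move=> a; rewrite !mxE le_eqVlt; apply/orP; left; apply/eqP; field.
Qed.

Lemma pascal_sum (R : pzRingType) n (f : nat -> R) :
  \sum_(i < n.+2) 'C(n.+1, i)%:R * f i =
  \sum_(i < n.+1) 'C(n, i)%:R * (f i.+1 + f i).
Proof.
rewrite big_ord_recl bin0 mul1r.
under eq_bigr do rewrite binS natrD mulrDl.
rewrite big_split /=.
under [RHS]eq_bigr do rewrite mulrDr.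
rewrite big_split /= [in RHS]addrC.
rewrite [X in _ = X + _]big_ord_recl bin0 mul1r /= -!addrA; congr (_ + (_ + _)).
by rewrite big_ord_recr /= bin_small// mul0r addr0.
Qed.

Lemma iter_rademacher (R : realType) (c : R) n phi x :
  iter n (cvl (rademacher c)) phi x =
  (2 ^+ n)^-1 * \sum_(i < n.+1) 'C(n, i)%:R *
    phi (x + const_mx (c * (i%:R *+ 2 - n%:R))).
Proof.
elim: n x => [|n IH] x.
  rewrite big_ord_recl big_ord0 /= bin0 expr0 invr1 !mul1r addr0 mul0rn subrr mulr0.
  by rewrite (_ : const_mx 0 = 0) ?addr0//; apply/matrixP => i j; rewrite !mxE.
have := pascal_sum n (fun i => phi (x + const_mx (c * (i%:R *+ 2 - n.+1%:R)))).
move=> /= ->; rewrite /cvl /rademacher !IH -mulrDr -big_split /=.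
have -> : (2 ^+ n.+1)^-1 = (2 ^+ n)^-1 / 2 :> R by rewrite exprSr invfM.
rewrite mulrAC; congr (_ * _); apply: eq_bigr => i _.
rewrite -mulrDr -!addrA; congr (_ * (phi (x + _) + phi (x + _))).
  by apply/matrixP => a b; rewrite !mxE -!natr1; ring.
by apply/matrixP => a b; rewrite !mxE -!natr1; ring.
Qed.

Lemma central_bin_ge j i : ('C(j.*2, i) <= 'C(j.*2, j))%N.
Proof.
have up h : ('C(j.*2, j + h) <= 'C(j.*2, j))%N.
  elim: h => [|h IH]; first by rewrite addn0.
  apply: leq_trans IH; rewrite -(@leq_pmul2l (j + h).+1)// addnS mul_bin_left.
  by rewrite leq_mul2r; apply/orP; right; rewrite -addnn; lia.
have [ji|ij] := leqP j i; first by rewrite -(subnKC ji).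
by rewrite -bin_sub -?addnn; [rewrite (_ : (j + j - i)%N = (j + (j - i))%N); [rewrite addnn|lia]|lia].
Qed.

(** Induction by C(2j+2, j+1) = 2 (2j+1)/(j+1) C(2j, j) and (2j+1)(2j+3) <= 4 (j+1)^2. The factor
    2j+1, rather than 2j, also serves the odd rows in [bin_sqr_le]. *)
Lemma central_bin_sqr j : ('C(j.*2, j) ^ 2 * j.*2.+1 <= 16 ^ j)%N.
Proof.
elim: j => [//|j IH].
have e1 : (j.+1 * 'C(j.+1.*2, j.+1) = j.+1 * (2 * 'C(j.*2.+1, j)))%N.
  by rewrite doubleS -mul_bin_diag /=; lia.
have e2 : (j.*2.+1 * 'C(j.*2, j) = j.+1 * 'C(j.*2.+1, j))%N.
  by have := mul_bin_down j.*2.+1 j; rewrite /= => ->; congr (_ * _)%N; lia.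
have {}e1 : 'C(j.+1.*2, j.+1) = (2 * 'C(j.*2.+1, j))%N.
  by apply/eqP; rewrite -(@eqn_pmul2l j.+1)//; apply/eqP.
rewrite e1 (expnS 16) -(@leq_pmul2l (j.+1 ^ 2))// ?expn_gt0//.
apply: (@leq_trans (j.+1 ^ 2 * (16 * ('C(j.*2, j) ^ 2 * j.*2.+1)))); last first.
  by rewrite leq_mul2l; apply/orP; right; rewrite leq_mul2l IH orbT.
move: e2; move: 'C(j.*2, j) 'C(j.*2.+1, j) => u v e2.
have -> : (j.+1 ^ 2 * ((2 * v) ^ 2 * j.+1.*2.+1) = 4 * (j.*2.+1 * u) ^ 2 * j.+1.*2.+1)%N.
  rewrite e2; lia.
have : (j.*2.+1 * j.+1.*2.+1 <= 4 * j.+1 ^ 2)%N by rewrite -!muln2; lia.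
move=> /(leq_mul (leqnn (4 * u ^ 2 * j.*2.+1))); lia.
Qed.

Lemma bin_sqr_le n i : ('C(n, i) ^ 2 * n <= 4 ^ n)%N.
Proof.
rewrite -[n]odd_double_half; set j := n./2.
have e4 : (4 ^ j.*2 = 16 ^ j)%N by rewrite -mul2n expnM.
case: (odd n) => /=; last first.
  rewrite add0n; apply: (@leq_trans ('C(j.*2, j) ^ 2 * j.*2.+1)).
    by rewrite leq_mul ?leq_exp2r// central_bin_ge.
  by rewrite e4 central_bin_sqr.
have h : ('C(j.*2.+1, i) <= 2 * 'C(j.*2, j))%N.
  case: i => [|i]; first by rewrite bin0; have := central_bin_ge j 0; rewrite bin0; lia.
  by rewrite binS; have := central_bin_ge j i.+1; have := central_bin_ge j i; lia.
rewrite add1n; apply: (@leq_trans ((2 * 'C(j.*2, j)) ^ 2 * j.*2.+1)).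
  by rewrite leq_mul2r leq_exp2r// h orbT.
rewrite expnMn -mulnA (expnS 4) leq_mul2l /=.
by rewrite e4 central_bin_sqr.
Qed.

Lemma bin_div_le (R : realType) n i : (0 < n)%N ->
  (2 ^+ n)^-1 * 'C(n, i)%:R <= (Num.sqrt n%:R)^-1 :> R.
Proof.
move=> n0; have n0' : 0 < n%:R :> R by rewrite ltr0n.
have s0 : 0 < Num.sqrt n%:R :> R by rewrite sqrtr_gt0.
have p0 : 0 < 2 ^+ n :> R by rewrite exprn_gt0.
rewrite mulrC ler_pdivrMr// mulrC ler_pdivlMr//.
rewrite -(@ler_pXn2r _ 2)// ?nnegrE ?mulr_ge0 ?(ltW s0) ?(ltW p0)//.
rewrite exprMn sqr_sqrtr ?(ltW n0')//.
have := bin_sqr_le n i; rewrite -(ler_nat R) natrM !natrX.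
by rewrite -exprM mulnC exprM -[2 ^+ 2]natrX.
Qed.

Lemma count_interval (R : realType) (al be : R) n :
  \sum_(i < n) `[< al < i%:R < be >]%:R <= Num.max 0 (be - al + 1).
Proof.
(* The truncated length is what the induction can follow: it never decreases, and it grows by 1
   whenever a new integer is counted. *)
apply: (@le_trans _ _ (Num.max 0 (Num.min n%:R (be + 1) - al))); last first.
  have : Num.min n%:R (be + 1) <= be + 1 by rewrite ge_min lexx orbT.
  move: (Num.min _ _) => z zb.
  by rewrite ge_max !le_max lexx /=; apply/orP; right; lra.
elim: n => [|n IH]; first by rewrite big_ord0 le_max lexx.
rewrite big_ord_recr /=; case: asboolP => [/andP[an nb]|_] /=; last first.
  rewrite addr0 (le_trans IH)// ge_max !le_max lexx /=; apply/orP; right.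
  by rewrite lerD2r le_min !ge_min lexx orbT andbT ler_nat leqnSn.
move: IH; rewrite (min_l (_ : n%:R <= be + 1)); last by lra.
rewrite (min_l (_ : n.+1%:R <= be + 1)); last by rewrite -natr1; lra.
rewrite !max_r; [|rewrite -natr1; lra|lra].
by rewrite -natr1; lra.
Qed.

Lemma rademacher_interval (R : realType) (s u u' : R) n : 0 < s -> (0 < n)%N -> u <= u' ->
  prob (normalized_sum n (rademacher s)) [set v | u < v 0 0 < u'] <=
  (u' - u) / (2 * s) + (Num.sqrt n%:R)^-1.
Proof.
move=> s0 n0 uu'.
have r0 : 0 < Num.sqrt n%:R :> R by rewrite sqrtr_gt0 ltr0n.
pose c := s / Num.sqrt n%:R.
have c0 : 0 < c by rewrite divr_gt0.
have -> : normalized_sum n (rademacher s) = fun phi => iter n (cvl (rademacher c)) phi 0.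
  apply/funext => phi; rewrite /normalized_sum; congr (iter _ (cvl _) _ _).
  apply/funext => psi; rewrite /scale_law /rademacher /c.
  congr ((psi _ + psi _) / 2); apply/matrixP => a b; rewrite !mxE; ring.
rewrite /prob iter_rademacher mulr_sumr.
(* The walk sits at c (2i - n) after i positive steps; [al] and [be] are the values of i
   corresponding to [u] and [u']. *)
pose al := (u / c + n%:R) / 2; pose be := (u' / c + n%:R) / 2.
apply: (@le_trans _ _ ((Num.sqrt n%:R)^-1 * \sum_(i < n.+1) `[< al < i%:R < be >]%:R)).
  rewrite mulr_sumr; apply: ler_sum => i _; rewrite mulrA.
  apply: ler_pM; [by rewrite mulr_ge0// invr_ge0 exprn_ge0|by []|exact: bin_div_le|].
  rewrite ler_nat; case: asboolP => //=; rewrite !mxE add0r => h.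
  rewrite asboolT// /al /be !ltr_pdivrMr// !ltr_pdivlMr// -ltrBrDr ltr_pdivrMr//.
  by rewrite -ltrBlDr ltr_pdivlMr//; move: h; rewrite mulr_natr mulrC.
apply: (@le_trans _ _ ((Num.sqrt n%:R)^-1 * (be - al + 1))).
  rewrite ler_wpM2l ?invr_ge0 ?(ltW r0)// (le_trans (count_interval _ _ _))// max_r//.
  rewrite /al /be -mulrBl addr_ge0// divr_ge0//.
  have : u / c <= u' / c by rewrite ler_pM2r ?invr_gt0.
  by lra.
rewrite le_eqVlt; apply/orP; left; apply/eqP; rewrite /al /be /c; field.
by rewrite !gt_eqF.
Qed.

Lemma ord1_forall (P : 'I_1 -> Prop) : (forall a, P a) = P 0.
Proof. by apply/propext; split => [//|p a]; rewrite ord1. Qed.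

Lemma itvcc_indic (R : realType) (x y z : R) : x <= y ->
  (x <= z <= y)%R%:R = (x <= z)%R%:R - (y < z)%R%:R :> R.
Proof.
by move=> xy; case: (leP x z) => h; case: (leP z y) => h' /=;
  rewrite ?subrr ?subr0 //; lra.
Qed.

Lemma itvoo_indic (R : realType) (x y z : R) : x < y ->
  (x < z < y)%R%:R = (x < z)%R%:R - (y <= z)%R%:R :> R.
Proof.
by move=> xy; case: (ltP x z) => h; case: (ltP z y) => h' /=;
  rewrite ?subrr ?subr0 //; lra.
Qed.

(** An interval is a difference of two half-lines, each a one-dimensional box. Moving both to the
    Rademacher sum of equal variance enlarges the interval by [3 * d] on either side. *)
Lemma anticoncentration (R : realType) (s d Q : R) :
  0 < s -> 0 < d -> 0 <= Q ->
  exists2 B : R, 0 <= B & forall E n (x w : R), (0 < n)%N -> 0 <= w ->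
  law 1 (fun _ _ => s ^+ 2) Q E ->
  prob (normalized_sum n E) [set v : 'cV_1 | x <= v 0 0 <= x + w] <=
    (w + 6 * d) / (2 * s) + B / Num.sqrt n%:R.
Proof.
move=> s0 d0 Q0; have s40 : 0 <= s ^+ 4 by rewrite exprn_ge0// ltW.
(* Both laws must obey one fourth-moment bound; [s ^+ 4] is that of the Rademacher step. *)
have Q0' : 0 <= Q + s ^+ 4 by rewrite addr_ge0.
have [B B0 HB] := @prob_box_compare R 1 d _ d0 Q0'.
(* Two comparisons cost 2B/sqrt n each, and the atom of the Rademacher sum costs 1/sqrt n. *)
exists (4 * B + 1); first by lra.
move=> E n x w n0 w0 lE.
have lE' : law 1 (fun _ _ => s ^+ 2) (Q + s ^+ 4) E.
  by apply: law_le_fourth lE; rewrite lerDl.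
have lR : law 1 (fun _ _ => s ^+ 2) (Q + s ^+ 4) (rademacher s).
  by apply: law_le_fourth (law_rademacher s); rewrite lerDr.
have k0 (a b : 'I_1) : `|s ^+ 2 - s ^+ 2| <= 0 by rewrite subrr normr0.
have h1 := HB _ _ _ _ 0 n n (x - 3 * d) n0 n0 (lexx _) lE' lR k0.
have h2 := HB _ _ _ _ 0 n n (x + w) n0 n0 (lexx _) lR lE' k0.
rewrite !subrK in h1; clear k0.
have hE := expectation_normalized_sum n lE.
have hR := expectation_normalized_sum n lR.
have e1 : prob (normalized_sum n E) [set v : 'cV_1 | x <= v 0 0 <= x + w] =
    prob (normalized_sum n E) [set v : 'cV_1 | forall a, x <= v a 0] -
    prob (normalized_sum n E) [set v : 'cV_1 | forall a, x + w < v a 0].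
  rewrite /prob -(expB hE); congr normalized_sum; apply/funext => v /=.
  by rewrite !ord1_forall !asboolb itvcc_indic// lerDl.
have xx : x - 3 * d < x + w + 3 * d by lra.
have e2 : prob (normalized_sum n (rademacher s)) [set v : 'cV_1 | x - 3 * d < v 0 0 < x + w + 3 * d] =
    prob (normalized_sum n (rademacher s)) [set v : 'cV_1 | forall a, x - 3 * d < v a 0] -
    prob (normalized_sum n (rademacher s)) [set v : 'cV_1 | forall a, x + w + 3 * d <= v a 0].
  rewrite /prob -(expB hR); congr normalized_sum; apply/funext => v /=.
  by rewrite !ord1_forall !asboolb itvoo_indic.
have := @rademacher_interval R s (x - 3 * d) (x + w + 3 * d) n s0 n0.
rewrite e1 e2 => /(_ (ltW xx)) h3.
have -> : (w + 6 * d) / (2 * s) = (x + w + 3 * d - (x - 3 * d)) / (2 * s).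
  by congr (_ / _); ring.
move: h1 h2 h3; move: (_ / (2 * s)) => y; move: (Num.sqrt n%:R)^-1 => z.
lra.
Qed.

(** * Multinomial laws *)

Definition mexp (R : realType) K (n : nat) (p : 'cV[R]_K) (F : ('I_K -> nat) -> R) : R :=
  \sum_(k : {ffun 'I_K -> 'I_n.+1})
    multinomial_pmf n p (fun i => k i : nat) * F (fun i => k i : nat).

Lemma multinomial_lawE (R : realType) K n (p : 'cV[R]_K) (A : set ('I_K -> nat)) :
  multinomial_law n p A = prob (mexp n p) A.
Proof.
rewrite /multinomial_law /prob /mexp big_mkcond /=; apply: eq_bigr => k _.
by case: asboolP => h; [rewrite mem_set// mulr1|rewrite memNset// mulr0].
Qed.

Definition incr_count K (k : 'I_K -> nat) (j : 'I_K) : 'I_K -> nat :=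
  fun i => (k i + (i == j))%N.

Definition decr_count K (k : 'I_K -> nat) (j : 'I_K) : 'I_K -> nat :=
  fun i => (k i - (i == j))%N.

Definition draw (R : realType) K (p : 'cV[R]_K) (F : ('I_K -> nat) -> R)
    (k : 'I_K -> nat) : R :=
  \sum_j p j 0 * F (incr_count k j).

Lemma sum_decr_count K (k : 'I_K -> nat) j : (0 < k j)%N ->
  (\sum_i k i = (\sum_i decr_count k j i).+1)%N.
Proof.
move=> kj; rewrite (bigD1 j)//= [X in X.+1](bigD1 j)//= /decr_count eqxx.
rewrite -addSn; congr (_ + _)%N; first by rewrite subn1 prednK.
by apply: eq_bigr => i /negbTE ->; rewrite subn0.
Qed.

(** Conditioning on the category of one draw: the factor n + 1 of (n+1)! is split as the sum of the
    counts. *)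
Lemma multinomial_pmf_rec (R : realType) K n (p : 'cV[R]_K) (k : 'I_K -> nat) :
  multinomial_pmf n.+1 p k =
  \sum_(j | (0 < k j)%N) p j 0 * multinomial_pmf n p (decr_count k j).
Proof.
rewrite /multinomial_pmf; case: eqP => [kn|kn]; last first.
  rewrite big1// => j kj; case: eqP => [kn'|_]; last by rewrite mulr0.
  by exfalso; apply: kn; rewrite (sum_decr_count kj) kn'.
pose c : R := n`!%:R / (\prod_i (k i)`!)%N%:R * \prod_i p i 0 ^+ k i.
transitivity (\sum_j (k j)%:R * c).
  rewrite -mulr_suml -natr_sum kn /c factS natrM; ring.
rewrite (bigID (fun j => (0 < k j)%N)) /= [X in _ + X]big1 ?addr0; last first.
  by move=> j; rewrite lt0n negbK => /eqP ->; rewrite mul0r.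
apply: eq_bigr => j kj; rewrite ifT; last first.
  by have := sum_decr_count kj; rewrite kn => -[->].
rewrite /c.
have -> : \prod_i p i 0 ^+ k i = p j 0 * \prod_i p i 0 ^+ decr_count k j i.
  rewrite (bigD1 j)//= [X in _ = _ * X](bigD1 j)//= mulrA /decr_count eqxx.
  congr (_ * _); first by case: (k j) kj => // q _; rewrite subn1 exprS.
  by apply: eq_bigr => i /negbTE ->; rewrite subn0.
have -> : (\prod_i (k i)`! = k j * \prod_i (decr_count k j i)`!)%N.
  rewrite (bigD1 j)//= [X in (_ = _ * X)%N](bigD1 j)//= mulnA /decr_count eqxx.
  congr (_ * _)%N; first by case: (k j) kj => // q _; rewrite subn1 factS.
  by apply: eq_bigr => i /negbTE ->; rewrite subn0.
rewrite natrM invfM; have kj0 : (k j)%:R != 0 :> R by rewrite pnatr_eq0 -lt0n.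
move: (k j)%:R kj0 (\prod_i _ ^+ _) (\prod_i _)%N%:R^-1 n`!%:R => w w0 z y x.
by field.
Qed.

(** The cap [N] on the counts is separate from the number of draws, so that the index type stays
    fixed while [n] decreases. *)
Lemma multinomial_pmf_iter (R : realType) K N n (p : 'cV[R]_K) F : (n <= N)%N ->
  \sum_(k : {ffun 'I_K -> 'I_N.+1})
    multinomial_pmf n p (fun i => k i : nat) * F (fun i => k i : nat) =
  iter n (draw p) F (fun=> 0%N).
Proof.
elim: n F => [|n IH] F nN.
  rewrite (bigD1 [ffun=> ord0])//= big1 ?addr0 => [|k k0].
    rewrite (_ : (fun i => _) = fun=> 0%N); last by apply/funext => i; rewrite ffunE.
    rewrite /multinomial_pmf big1// eqxx big1// big1//.
    by rewrite fact0 invr1 !mul1r.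
  rewrite /multinomial_pmf; case: eqP => [/eqP ks|_]; last by rewrite mul0r.
  move: k0; rewrite sum_nat_eq0 in ks; move/forallP: ks => ks.
  by case/eqP; apply/ffunP => i; apply/val_inj; rewrite ffunE /=; apply/eqP; have := ks i.
rewrite iterSr -IH ?(ltnW nN)//.
under eq_bigr => k _ do rewrite multinomial_pmf_rec mulr_suml.
rewrite (exchange_big_dep predT)//= [RHS](eq_bigr (fun k : {ffun 'I_K -> 'I_N.+1} =>
  \sum_j p j 0 * multinomial_pmf n p (fun i => k i : nat) *
    F (incr_count (fun i => k i : nat) j))); last first.
  by move=> k _; rewrite /draw mulr_sumr; apply: eq_bigr => j _; ring.
rewrite [RHS]exchange_big; apply: eq_bigr => j _ /=.
pose up (k : {ffun 'I_K -> 'I_N.+1}) : {ffun 'I_K -> 'I_N.+1} :=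
  [ffun i => inord (k i + (i == j))].
pose down (k : {ffun 'I_K -> 'I_N.+1}) : {ffun 'I_K -> 'I_N.+1} :=
  [ffun i => inord (k i - (i == j))].
have downE k i : down k i = (k i - (i == j))%N :> nat.
  by rewrite ffunE inordK// ltnS (leq_trans (leq_subr _ _))// -ltnS.
have upE (k : {ffun 'I_K -> 'I_N.+1}) i : (k j < N)%N -> up k i = (k i + (i == j))%N :> nat.
  move=> kjN; rewrite ffunE inordK//; case: eqP => [->|_]; first by rewrite addn1 ltnS.
  by rewrite addn0.
rewrite (reindex_onto up down) /=; last first.
  move=> k kj; apply/ffunP => i; apply/val_inj; rewrite [LHS]/= ffunE inordK.
    by rewrite downE; case: eqP => [->|_]; rewrite ?subnK ?subn0 ?addn0.
  by rewrite downE; case: eqP => [->|_]; rewrite ?subnK ?subn0 ?addn0.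
(* If [k j] is already [N], the increment overflows and [inord] falls back on 0, so the condition
   [0 < up k j] discards such [k]. *)
rewrite (eq_bigl (fun k : {ffun 'I_K -> 'I_N.+1} => (k j < N)%N)); last first.
  move=> k; have [kjN|] := ltnP (k j) N.
    rewrite upE// eqxx addn1 ltnS leq0n /=; apply/eqP/ffunP => i; apply/val_inj.
    by rewrite /= downE upE// addnK.
  move=> Nk; have kjN : k j = N :> nat by apply/eqP; rewrite eqn_leq Nk -ltnS ltn_ord.
  apply/negbTE; rewrite negb_and -leqNgt; apply/orP; left.
  rewrite ffunE eqxx addn1 kjN /inord /insubd insubF//=.
  by rewrite ltnn.
rewrite [RHS](bigID (fun k : {ffun 'I_K -> 'I_N.+1} => (k j < N)%N)) /=.
(* The tables discarded on the left contribute nothing on the right either: their total is at least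
   [N], hence exceeds [n]. *)
rewrite [X in _ = _ + X]big1 ?addr0 => [|k]; last first.
  rewrite -leqNgt => Nk; rewrite /multinomial_pmf ifF ?mulr0 ?mul0r//.
  apply/negbTE; rewrite neq_ltn; apply/orP; right.
  by rewrite (bigD1 j)//= (leq_trans nN)// (leq_trans Nk)// leq_addr.
apply: eq_bigr => k kjN; congr (_ * multinomial_pmf n p _ * F _).
  by apply/funext => i; rewrite /decr_count upE// addnK.
by apply/funext => i; rewrite upE.
Qed.

Lemma mexp_iter (R : realType) K n (p : 'cV[R]_K) F :
  mexp n p F = iter n (draw p) F (fun=> 0%N).
Proof. exact: multinomial_pmf_iter. Qed.

Lemma multinomial_pmf_ge0 (R : realType) K n (p : 'cV[R]_K) k :
  simplex p -> 0 <= multinomial_pmf n p k.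
Proof.
move=> [p0 _]; rewrite /multinomial_pmf; case: ifP => // _.
by rewrite mulr_ge0 ?divr_ge0// prodr_ge0// => i _; rewrite exprn_ge0.
Qed.

Lemma expectation_mexp (R : realType) K n (p : 'cV[R]_K) :
  simplex p -> expectation (mexp n p).
Proof.
move=> sp; split.
- move=> c F G; rewrite /mexp mulr_sumr -big_split; apply: eq_bigr => k _ /=; ring.
- by move=> F G FG; apply: ler_sum => k _; rewrite ler_wpM2l// multinomial_pmf_ge0.
- rewrite mexp_iter; elim: n => // n IH; rewrite iterSr -[RHS]IH; congr (iter n _ _ _).
  apply/funext => k; rewrite /draw -mulr_suml mulr1; by case: sp.
Qed.

Definition counts_support (R : realType) K n (p : 'cV[R]_K) (k : 'I_K -> nat) : Prop :=
  (\sum_i k i = n)%N /\ forall i, p i 0 = 0 -> k i = 0%N.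

Lemma multinomial_pmf_support (R : realType) K n (p : 'cV[R]_K) k :
  ~ counts_support n p k -> multinomial_pmf n p k = 0.
Proof.
move=> h; rewrite /multinomial_pmf; case: eqP => // ks.
have : exists i, p i 0 = 0 /\ k i <> 0%N.
  apply: contrapT => /forallNP h'; apply: h; split => // i pi0.
  by apply: contrapT => ki; apply: (h' i).
move=> [i [pi0 ki]]; rewrite [X in _ * X](bigD1 i)//= pi0 expr0n.
by move/eqP/negbTE: ki => ->; rewrite mul0r mulr0.
Qed.

(** Inclusion is asked only on the support, where frequencies lie on the face of [p]; the
    zero-variance forms vanish only there. *)
Lemma prob_mexp_le (R : realType) K n (p : 'cV[R]_K) (S S' : set ('I_K -> nat)) :
  simplex p -> (forall k, counts_support n p k -> S k -> S' k) ->
  prob (mexp n p) S <= prob (mexp n p) S'.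
Proof.
move=> sp SS'; apply: ler_sum => k _.
have [h|h] := pselect (counts_support n p (fun i => k i : nat)); last first.
  by rewrite multinomial_pmf_support// !mul0r.
rewrite ler_wpM2l ?multinomial_pmf_ge0// ler_nat.
by case: asboolP => // Sk; rewrite asboolT//; exact: SS'.
Qed.

Lemma freq_simplex (R : realType) K n (p : 'cV[R]_K) k : (0 < n)%N ->
  counts_support n p k -> simplex (freq R n k).
Proof.
move=> n0 [ks _]; split => [i|]; first by rewrite mxE divr_ge0.
under eq_bigr do rewrite mxE.
by rewrite -mulr_suml -natr_sum ks divff// pnatr_eq0 -lt0n.
Qed.

Lemma freq_support (R : realType) K n (p : 'cV[R]_K) k i :
  counts_support n p k -> p i 0 = 0 -> freq R n k i 0 = 0.
Proof. by move=> [_ h] /h ki; rewrite mxE ki mul0r. Qed.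

(** * Linear images of multinomial counts as normalized sums *)

Definition categorical (R : realType) k K (A : 'M[R]_(k, K)) (p : 'cV[R]_K)
    (phi : 'cV[R]_k -> R) : R :=
  \sum_j p j 0 * phi (A *m (delta_mx j 0 - p)).

Definition cov_mx (R : realType) k K (A : 'M[R]_(k, K)) (p : 'cV[R]_K) (a b : 'I_k) : R :=
  \sum_j p j 0 * ((A *m (delta_mx j 0 - p)) a 0 * (A *m (delta_mx j 0 - p)) b 0).

Section categorical_law.
Context (R : realType) (k K : nat) (A : 'M[R]_(k, K)).
Implicit Types (p q : 'cV[R]_K).

Lemma simplex_le1 p i : simplex p -> p i 0 <= 1.
Proof. by move=> [p0 <-]; rewrite (bigD1 i)//= lerDl sumr_ge0. Qed.

Lemma mulmx_delta_col (j : 'I_K) a : (A *m delta_mx j 0 : 'cV[R]_k) a 0 = A a j.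
Proof.
rewrite mxE (bigD1 j)//= mxE !eqxx mulr1 big1 ?addr0// => i /negbTE ij.
by rewrite mxE ij mulr0.
Qed.

Lemma centered_entry p j a :
  (A *m (delta_mx j 0 - p)) a 0 = A a j - \sum_i A a i * p i 0.
Proof. by rewrite mulmxBr mxE mulmx_delta_col !mxE. Qed.

Lemma mulmx_simplex_le (B : R) p a : simplex p -> (forall a i, `|A a i| <= B) ->
  `|\sum_i A a i * p i 0| <= B.
Proof.
move=> [p0 p1] AB; apply: (le_trans (ler_norm_sum _ _ _)).
rewrite -[leRHS]mulr1 -p1 mulr_sumr; apply: ler_sum => i _.
by rewrite normrM (ger0_norm (p0 i)) ler_wpM2r.
Qed.

Lemma centered_entry_le (B : R) p j a : simplex p -> (forall a i, `|A a i| <= B) ->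
  `|(A *m (delta_mx j 0 - p)) a 0| <= 2 * B.
Proof.
move=> sp AB; rewrite centered_entry (le_trans (ler_normB _ _))//.
have := AB a j; have := mulmx_simplex_le a sp AB; lra.
Qed.

Lemma expectation_categorical p : simplex p -> expectation (categorical A p).
Proof.
move=> [p0 p1]; split.
- by move=> c F G; rewrite /categorical mulr_sumr -big_split; apply: eq_bigr => j _ /=; ring.
- by move=> F G FG; apply: ler_sum => j _; rewrite ler_wpM2l.
- by rewrite /categorical -[RHS]p1; apply: eq_bigr => j _; rewrite mulr1.
Qed.

Lemma law_categorical (B : R) p : simplex p -> (forall a i, `|A a i| <= B) ->
  law 1 (cov_mx A p) ((2 * B) ^+ 4) (categorical A p).
Proof.
move=> sp AB; have [p0 p1] := sp; have hE := expectation_categorical sp; split => //.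
- move=> a; rewrite /categorical; under eq_bigr do rewrite centered_entry mulrBr.
  rewrite sumrB -mulr_suml p1 mul1r.
  by rewrite (eq_bigr (fun i => A a i * p i 0)) ?subrr// => i _; rewrite mulrC.
- by move=> a b; rewrite expr1n mul1r.
- move=> a; rewrite expr1n mul1r -[leRHS](exp_cst hE).
  apply: ler_sum => j _; rewrite ler_wpM2l//.
  have := centered_entry_le j a sp AB; move: (_ a 0) => z zB.
  rewrite (le_trans (ler_norm _))// normrX; apply: lerXn2r; rewrite ?nnegrE//.
  exact: le_trans zB.
Qed.

Lemma cov_mxE p a b : simplex p ->
  cov_mx A p a b = \sum_j p j 0 * (A a j * A b j) -
    (\sum_j A a j * p j 0) * (\sum_j A b j * p j 0).
Proof.
move=> [_ p1]; rewrite /cov_mx; under eq_bigr do rewrite !centered_entry.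
set u := \sum_j A a j * _; set v := \sum_j A b j * _.
transitivity (\sum_j (p j 0 * (A a j * A b j) - v * (A a j * p j 0) - u * (A b j * p j 0) +
   u * v * p j 0)); first by apply: eq_bigr => j _; ring.
rewrite big_split /= !sumrB -!mulr_sumr -/u -/v p1; ring.
Qed.

(** The factor 3 counts one term for the second moments and two for the product of means. It
    controls the covariance gap between [fstar] and an observed frequency vector. *)
Lemma cov_mx_dist (B : R) p q a b : simplex p -> simplex q ->
  (forall a i, `|A a i| <= B) ->
  `|cov_mx A p a b - cov_mx A q a b| <= 3 * B ^+ 2 * norm1 (p - q).
Proof.
move=> sp sq AB; rewrite !cov_mxE//.
have B0 : B ^+ 2 * norm1 (p - q) = \sum_j B * B * `|p j 0 - q j 0|.
  by rewrite /norm1 mulr_sumr; apply: eq_bigr => j _; rewrite !mxE expr2.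
have d1 : `|\sum_j p j 0 * (A a j * A b j) - \sum_j q j 0 * (A a j * A b j)| <=
    B ^+ 2 * norm1 (p - q).
  rewrite -sumrB B0 (le_trans (ler_norm_sum _ _ _))//; apply: ler_sum => j _.
  by rewrite -mulrBl mulrC !normrM ler_wpM2r// ler_pM.
have d2 c : `|\sum_j A c j * p j 0 - \sum_j A c j * q j 0| <= B * norm1 (p - q).
  rewrite -sumrB /norm1 mulr_sumr (le_trans (ler_norm_sum _ _ _))//; apply: ler_sum => j _.
  by rewrite !mxE -mulrBr normrM ler_wpM2r.
have := mulmx_simplex_le b sp AB; have := mulmx_simplex_le a sq AB.
move: (d2 a) (d2 b) d1.
move: (\sum_j p j 0 * _) (\sum_j q j 0 * _) => x y.
move: (\sum_j A a j * p j 0) (\sum_j A b j * p j 0) => u v.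
move: (\sum_j A a j * q j 0) (\sum_j A b j * q j 0) => u' v' hu hv hx hu' hv'.
have -> : x - u * v - (y - u' * v') = (x - y) - (u - u') * v - u' * (v - v') by ring.
have e1 : `|(u - u') * v| <= B ^+ 2 * norm1 (p - q).
  by rewrite normrM expr2 -mulrA [leRHS]mulrC ler_pM.
have e2 : `|u' * (v - v')| <= B ^+ 2 * norm1 (p - q).
  by rewrite normrM expr2 -mulrA ler_pM.
move: hx e1 e2; rewrite -(mulrA 3); move: (B ^+ 2 * _) => w.
by rewrite !ler_norml; move: (_ * v) (u' * _) => z z'; lra.
Qed.

Definition counts_col (c : 'I_K -> nat) : 'cV[R]_K := \col_i (c i)%:R.

(** Draws add uncentred unit vectors, whereas [categorical] is centred; the difference accumulates
    as the drift in [A *m p]. The offset [y] is general so that the induction can pass one drift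
    term into it. *)
Lemma iter_draw_categorical p s n phi y c :
  iter n (draw p) (fun c => phi (s *: (A *m counts_col c) + y)) c =
  iter n (cvl (scale_law s (categorical A p))) phi
    (s *: (A *m counts_col c) + y + n%:R *: (s *: (A *m p))).
Proof.
elim: n phi y c => [|n IH] phi y c; first by rewrite /= scale0r addr0.
rewrite !iterSr.
have -> : draw p (fun c => phi (s *: (A *m counts_col c) + y)) =
    fun c => cvl (scale_law s (categorical A p)) phi
      (s *: (A *m counts_col c) + (y + s *: (A *m p))).
  apply/funext => c'; rewrite /draw /cvl /scale_law /categorical.
  apply: eq_bigr => j _; congr (_ * phi _).
  have -> : counts_col (incr_count c' j) = counts_col c' + delta_mx j 0.
    by apply/colP => i; rewrite !mxE eqxx andbT natrD.
  rewrite !mulmxDr mulmxN !scalerDr scalerN -!addrA; congr (_ + _).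
  by rewrite addrC; congr (_ + _); rewrite addrCA subrr addr0.
rewrite IH -!addrA; congr (iter n _ _ (_ + (_ + _))).
by rewrite -natr1 scalerDl scale1r addrC.
Qed.

Definition deviation n p (c : 'I_K -> nat) : 'cV[R]_k :=
  Num.sqrt n%:R *: (A *m (freq R n c - p)).

Lemma mexp_deviation n p phi : (0 < n)%N ->
  mexp n p (fun c => phi (deviation n p c)) =
  normalized_sum n (categorical A p) phi.
Proof.
move=> n0; rewrite mexp_iter /normalized_sum.
have n0' : n%:R != 0 :> R by rewrite pnatr_eq0 -lt0n.
have ss : Num.sqrt n%:R * Num.sqrt n%:R = n%:R :> R by rewrite -expr2 sqr_sqrtr.
have s0 : Num.sqrt n%:R != 0 :> R by rewrite sqrtr_eq0 -ltNge ltr0n.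
set s := Num.sqrt n%:R in ss s0 *.
(* The offset is minus the total drift, so the convolution starts from 0. *)
have := iter_draw_categorical p s^-1 n phi (- (n%:R *: (s^-1 *: (A *m p)))) (fun=> 0%N).
rewrite subrK.
have -> : counts_col (fun=> 0%N) = 0 by apply/colP => i; rewrite !mxE.
rewrite mulmx0 scaler0 => <-; congr (iter n _ _ _); apply/funext => c; congr (phi _).
rewrite /deviation -/s.
have -> : freq R n c = n%:R^-1 *: counts_col c by apply/colP => i; rewrite !mxE mulrC.
rewrite mulmxBr scalerBr -scalemxAr !scalerA -ss; congr (_ *: _ - _ *: _).
  by rewrite invfM mulrA divff// mul1r.
by rewrite mulfK.
Qed.

Lemma prob_deviation n p (S : set 'cV[R]_k) : (0 < n)%N ->
  prob (mexp n p) [set c | S (deviation n p c)] =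
  prob (normalized_sum n (categorical A p)) S.
Proof. exact: (mexp_deviation p (fun v => `[< S v >]%:R)). Qed.

Lemma entry_bound : exists2 B : R, 0 <= B & forall a i, `|A a i| <= B.
Proof.
exists (\sum_a \sum_i `|A a i|); first by apply: sumr_ge0 => a _; apply: sumr_ge0.
move=> a i; rewrite (bigD1 a)//= (bigD1 i)//= -addrA lerDl addr_ge0 ?sumr_ge0// => b _.
exact: sumr_ge0.
Qed.

Lemma multinomial_box_compare (d : R) : 0 < d ->
  exists2 B : R, 0 <= B & forall n m p q (x : R), (0 < n)%N -> (0 < m)%N ->
  simplex p -> simplex q ->
  prob (mexp n p) [set c | forall a, x + 3 * d <= deviation n p c a 0] <=
  prob (mexp m q) [set c | forall a, x < deviation m q c a 0] +
  B * (norm1 (p - q) + (Num.sqrt n%:R)^-1 + (Num.sqrt m%:R)^-1).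
Proof.
move=> d0; have [b b0 Ab] := entry_bound.
have Q0 : 0 <= (2 * b) ^+ 4 by rewrite exprn_ge0//; lra.
have [B B0 HB] := @prob_box_compare R k d _ d0 Q0.
have b20 : 0 <= 3 * b ^+ 2 by rewrite mulr_ge0// sqr_ge0.
exists (B * (3 * b ^+ 2 + 1)); first by rewrite mulr_ge0//; lra.
move=> n m p q x n0 m0 sp sq.
rewrite (prob_deviation p [set v | forall a, x + 3 * d <= v a 0] n0).
rewrite (prob_deviation q [set v | forall a, x < v a 0] m0).
have N0 := norm1_ge0 (p - q).
apply: (le_trans (HB _ _ _ _ (3 * b ^+ 2 * norm1 (p - q)) n m x n0 m0 _
  (law_categorical sp Ab) (law_categorical sq Ab) _)).
- exact: mulr_ge0.
- by move=> a a'; exact: cov_mx_dist.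
- rewrite lerD2l -[leRHS]mulrA ler_wpM2l//.
  have : 0 <= (Num.sqrt n%:R)^-1 :> R by rewrite invr_ge0 sqrtr_ge0.
  have : 0 <= (Num.sqrt m%:R)^-1 :> R by rewrite invr_ge0 sqrtr_ge0.
  move: (_^-1) (_^-1) b20 N0; move: (3 * _) (norm1 _) => u v z z' u0 v0 z0 z0'.
  by have := mulr_ge0 u0 z0; have := mulr_ge0 u0 z0'; nra.
Qed.

Lemma mexp_deviation_sqr n p a : (0 < n)%N -> simplex p ->
  mexp n p (fun c => deviation n p c a 0 ^+ 2) = cov_mx A p a a.
Proof.
move=> n0 sp; rewrite (mexp_deviation p (fun v => v a 0 ^+ 2) n0).
have [b b0 Ab] := entry_bound.
have Q0 : 0 <= (2 * b) ^+ 4 by rewrite exprn_ge0//; lra.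
have [_ _ h _] := law_block n Q0 (law_scale (Num.sqrt n%:R)^-1 (law_categorical sp Ab)).
have := h a a; rewrite mulVf ?sqrtr_eq0 -?ltNge ?ltr0n// expr1n mul1r => <-.
by congr block_law; apply/funext => v; rewrite expr2.
Qed.

End categorical_law.

Lemma multinomial_anticoncentration (R : realType) k K (A : 'M[R]_(k, K))
    (p : 'cV[R]_K) a (e : R) :
  simplex p -> 0 < cov_mx A p a a -> 0 < e ->
  exists2 w : R, 0 < w & exists2 B : R, 0 <= B & forall n (x : R), (0 < n)%N ->
  prob (mexp n p) [set c | x <= deviation A n p c a 0 <= x + w] <=
  e + B / Num.sqrt n%:R.
Proof.
move=> sp cov0 e0; have [b b0 Ab] := entry_bound (row a A).
have Q0 : 0 <= (2 * b) ^+ 4 by rewrite exprn_ge0//; lra.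
pose s := Num.sqrt (cov_mx A p a a).
have s0 : 0 < s by rewrite sqrtr_gt0.
(* With width [d] and smoothing [d] the bound is 7 d/(2 s) = e/2. *)
pose d := e * s / 7.
have d0 : 0 < d by rewrite divr_gt0// mulr_gt0.
have [B B0 HB] := anticoncentration s0 d0 Q0.
exists d => //; exists B => // n x n0.
have rowE c : deviation A n p c a 0 = deviation (row a A) n p c 0 0.
  by rewrite /deviation -row_mul !mxE.
have -> : [set c | x <= deviation A n p c a 0 <= x + d] =
    [set c | [set v : 'cV_1 | x <= v 0 0 <= x + d] (deviation (row a A) n p c)].
  by apply/funext => c /=; rewrite rowE.
rewrite prob_deviation//.
have lE : law 1 (fun _ _ => s ^+ 2) ((2 * b) ^+ 4) (categorical (row a A) p).
  have := law_categorical sp Ab; congr law.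
  apply/funext => i; apply/funext => j; rewrite !ord1 sqr_sqrtr ?(ltW cov0)//.
  by apply: eq_bigr => l _; rewrite -row_mul !mxE.
apply: (le_trans (HB _ n x d n0 (ltW d0) lE)); rewrite lerD2r.
rewrite ler_pdivrMr ?mulr_gt0// /d; have := mulr_gt0 e0 s0; lra.
Qed.

(** Markov on the squared deviations for the identity matrix, whose variances are at most 1, with a
    union over the [K] coordinates. *)
Lemma multinomial_chebyshev (R : realType) K n (p : 'cV[R]_K) (t : R) :
  (0 < n)%N -> simplex p -> 0 < t ->
  prob (mexp n p) [set c | exists i, t <= `|freq R n c i 0 - p i 0|] <=
  K%:R / (n%:R * t ^+ 2).
Proof.
move=> n0 sp t0; have hE := expectation_mexp n sp.
have n0' : 0 < n%:R :> R by rewrite ltr0n.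
apply: (le_trans (prob_bigcup hE _)).
have -> : K%:R / (n%:R * t ^+ 2) = \sum_(i < K) (n%:R * t ^+ 2)^-1.
  by rewrite sumr_const card_ord mulr_natl.
apply: ler_sum => i _.
pose S := [set c : 'I_K -> nat | n%:R * t ^+ 2 <= deviation 1%:M n p c i 0 ^+ 2].
apply: (@le_trans _ _ (prob (mexp n p) S)).
  apply: (prob_le hE) => c /= h.
  rewrite /S/= /deviation mul1mx !mxE exprMn sqr_sqrtr ?(ltW n0')// ler_pM2l//.
  rewrite mxE in h; rewrite -[leRHS]real_normK ?num_real//.
  by apply: lerXn2r; rewrite ?nnegrE ?(ltW t0).
apply: (le_trans (markov_prob hE _ _)); first by rewrite mulr_gt0// exprn_gt0.
  by move=> c; exact: sqr_ge0.
rewrite mexp_deviation_sqr// -[leRHS]mul1r ler_wpM2r ?invr_ge0 ?mulr_ge0 ?exprn_ge0 ?(ltW n0') ?(ltW t0)//.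
rewrite /cov_mx; have [p0 p1] := sp; rewrite -[leRHS]p1; apply: ler_sum => j _.
rewrite -[leRHS]mulr1 ler_wpM2l// mul1mx !mxE -expr2.
have := p0 i; have := simplex_le1 i sp; rewrite andbT => h1 h0.
by rewrite -real_normK ?num_real// exprn_ile1// ler_norml; case: (i == j) => /=; apply/andP; split; lra.
Qed.

(** Finitely many disjoint atoms give a lower bound for every event. Applied to the complement as
    well, it becomes an equality, so tables outside the finite index set need no separate
    treatment. *)
Lemma probability_multinomial d (T : measurableType d) (R : realType)
    (P : probability T R) K n (p : 'cV[R]_K) (X : 'I_K -> {RV P >-> nat})
    (S : set ('I_K -> nat)) :
  simplex p -> multinomial_rv n p X ->
  P [set w | S (fun i => X i w)] = (prob (mexp n p) S)%:E.
Proof.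
move=> sp hX.
pose atom (k : 'I_K -> nat) := [set w | forall i, X i w = k i].
have mX k : measurable (atom k).
  rewrite (_ : atom k = \bigcap_(i in [set: 'I_K]) (X i @^-1` [set k i])); last first.
    by apply/seteqP; split => w /= h i => [_|]; exact: h.
  apply: fin_bigcap_measurable => // i _.
  by rewrite -[_ @^-1` _]setTI; exact: measurable_funP.
have mS (S' : set ('I_K -> nat)) : measurable [set w | S' (fun i => X i w)].
  rewrite (_ : [set w | _] = \bigcup_(k : {ffun 'I_K -> nat})
      (if `[< S' k >] then atom k else set0)); last first.
    apply/seteqP; split => w /=.
      move=> Sw; exists [ffun i => X i w] => //.
      have e : [ffun i => X i w] = (fun i => X i w) :> ('I_K -> nat).
        by apply/funext => i; rewrite ffunE.
      by rewrite e asboolT//= => i; rewrite e.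
    move=> [k _]; case: asboolP => //= Sk wk.
    by rewrite (_ : (fun i => X i w) = k)//; apply/funext.
  by apply: countable_bigcupT_measurable => // k; case: ifP.
pose cnt (k : {ffun 'I_K -> 'I_n.+1}) : 'I_K -> nat := fun i => k i.
have lower (S' : set ('I_K -> nat)) :
    ((prob (mexp n p) S')%:E <= P [set w | S' (fun i => X i w)])%E.
  pose F k := if `[< S' (cnt k) >] then atom (cnt k) else set0.
  pose D := [set` index_enum {ffun 'I_K -> 'I_n.+1}].
  have finD : finite_set D by exact: finite_finset.
  have mF k : measurable (F k) by rewrite /F; case: ifP.
  have -> : (prob (mexp n p) S')%:E = P (\bigcup_(k in D) F k).
    rewrite measure_fin_bigcup//; last first.
      move=> k k' _ _ [w []]; rewrite /F; case: asboolP => //= _ h; case: asboolP => //= _ h'.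
      by apply/ffunP => i; apply/val_inj; rewrite /= -[LHS]h h'.
    have <- := @fsbig_seq (\bar R) 0%E +%E _ _ (fun k => P (F k)) (index_enum_uniq _).
    rewrite /prob /mexp -sumEFin.
    apply: eq_bigr => k _; rewrite -/(cnt k) /F; case: asboolP => _.
      by rewrite mulr1 -hX.
    by rewrite mulr0 measure0.
  apply: le_measure; rewrite ?inE//; first exact: fin_bigcup_measurable.
  move=> w [k _]; rewrite /F; case: asboolP => //= Sk wk.
  by rewrite (_ : (fun i => X i w) = cnt k)//; apply/funext.
apply/eqP; rewrite eq_le lower andbT.
have := lower (~` S); rewrite (probC (expectation_mexp n sp)).
have -> : [set w | (~` S) (fun i => X i w)] = ~` [set w | S (fun i => X i w)] by [].
rewrite probability_setC//; have /fineK <- := fin_num_measure P _ (mS S).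
by rewrite -EFinB !lee_fin lerD2l lerN2.
Qed.

(** * The audit value as a minimum of linear forms *)

Section fourier_motzkin.
Context (R : realType).

Lemma exists_lower_bound (U : seq R) (z : R) : (forall u, u \in U -> z < u) ->
  exists2 t, z < t & forall u, u \in U -> t <= u.
Proof.
elim: U => [|u U IH] zU; first by exists (z + 1) => //; rewrite ltrDl.
have [|t zt tU] := IH; first by move=> v vU; apply: zU; rewrite inE vU orbT.
exists (Num.min t u); first by rewrite lt_min zt zU// inE eqxx.
move=> v; rewrite inE => /predU1P[->|vU]; rewrite ge_min ?lexx ?orbT//.
by rewrite tU.
Qed.

Lemma exists_between (L U : seq R) :
  (forall a b, a \in L -> b \in U -> a <= b) ->
  exists t, (forall a, a \in L -> a <= t) /\ (forall b, b \in U -> t <= b).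
Proof.
elim: L => [|a L IH] LU.
  have [|t _ tU] := @exists_lower_bound U (- \sum_(u <- U) `|u| - 1).
    move=> u uU; have : `|u| <= \sum_(u <- U) `|u|.
      by rewrite (big_rem u)//= lerDl sumr_ge0.
    by have := ler_norm (- u); rewrite normrN; lra.
  by exists t.
have [|t [Lt tU]] := IH.
  by move=> a' b a'L bU; apply: LU => //; rewrite inE a'L orbT.
exists (Num.max t a); split => [a'|b bU].
  rewrite inE => /predU1P[->|a'L]; rewrite le_max ?lexx ?orbT//.
  by rewrite Lt.
by rewrite ge_max tU//= LU// inE eqxx.
Qed.

Lemma one_variable_elim (T : eqType) (s : seq T) (g a : T -> R) :
  (forall c, c \in s -> a c = 0 -> g c <= 0) ->
  (forall c d, c \in s -> d \in s -> 0 < a c -> a d < 0 -> - a d * g c + a c * g d <= 0) ->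
  exists t, forall c, c \in s -> g c + a c * t <= 0.
Proof.
move=> h0 h1.
have [|t [tL tU]] := @exists_between [seq - g d / a d | d <- s & a d < 0]
    [seq - g c / a c | c <- s & 0 < a c].
  move=> _ _ /mapP[d + ->] /mapP[c + ->]; rewrite !mem_filter => /andP[ad ds] /andP[ac cs].
  rewrite ler_pdivlMr// mulrAC ler_ndivrMr//.
  by have := h1 c d cs ds ac ad; lra.
exists t => c cs; have [ac|ac|ac] := ltgtP (a c) 0.
- have := tL (- g c / a c); rewrite ler_ndivrMr//.
  by move=> /(_ (map_f _ _)); rewrite mem_filter ac cs => /(_ isT); lra.
- have := tU (- g c / a c); rewrite ler_pdivlMr//.
  by move=> /(_ (map_f _ _)); rewrite mem_filter ac cs => /(_ isT); lra.
- by rewrite ac mul0r addr0 h0.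
Qed.

Context (J I : finType).

(** Homogeneous inequalities, with parameters [J] and eliminated variables [I]. Constants are
    recovered later by multiplying them by the total mass of a simplex point. *)
Definition constraint : Type := ({ffun J -> R} * {ffun I -> R})%type.

Definition slack (r : seq I) (x : J -> R) (y : I -> R) (c : constraint) : R :=
  \sum_j c.1 j * x j + \sum_(i <- r) c.2 i * y i.

Definition combine (u v : R) (c d : constraint) : constraint :=
  ([ffun j => u * c.1 j + v * d.1 j], [ffun i => u * c.2 i + v * d.2 i]).

Lemma slack_combine r x y u v c d :
  slack r x y (combine u v c d) = u * slack r x y c + v * slack r x y d.
Proof.
rewrite /slack /= !mulrDr addrACA !mulr_sumr -!big_split; congr (_ + _);
  by apply: eq_bigr => i _ /=; rewrite ffunE; ring.
Qed.

Lemma fourier_motzkin (r : seq I) : uniq r -> forall s : seq constraint,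
  exists s' : seq {ffun J -> R}, forall x,
  (exists y, forall c, c \in s -> slack r x y c <= 0) <->
  (forall c, c \in s' -> \sum_j c j * x j <= 0).
Proof.
elim: r => [|i r IH] /= => [_ s|/andP[ir ur] s].
  exists [seq c.1 | c <- s] => x; split.
    by move=> [y h] _ /mapP[c cs ->]; have := h c cs; rewrite /slack big_nil addr0.
  move=> h; exists (fun=> 0) => c cs; rewrite /slack big_nil addr0.
  by apply: h; exact: map_f.
(* Constraints free of [y i] are kept; each pair with opposite signs at [i] is combined positively
   so that [y i] cancels. *)
pose s1 := [seq c : constraint <- s | c.2 i == 0] ++
  [seq (fun c d : constraint => combine (- d.2 i) (c.2 i) c d) c d |
     c <- [seq c : constraint <- s | 0 < c.2 i],
     d <- [seq d : constraint <- s | d.2 i < 0]].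
have slackS x y c : slack (i :: r) x y c = slack r x y c + c.2 i * y i.
  by rewrite /slack big_cons; ring.
have [s' hs'] := IH ur s1; exists s' => x; rewrite -hs'; split => -[y hy]; last first.
  have [||t ht] := @one_variable_elim _ s (slack r x y) (fun c : constraint => c.2 i).
  - by move=> c cs /eqP ci; apply: hy; rewrite mem_cat mem_filter ci cs.
  - move=> c d cs ds ci di; rewrite -slack_combine; apply: hy.
    by rewrite mem_cat; apply/orP; right; apply: allpairs_f; rewrite mem_filter ?ci ?di.
  exists (fun i' => if i' == i then t else y i') => c cs.
  rewrite slackS eqxx (_ : slack r x _ c = slack r x y c) ?ht//.
  rewrite /slack; congr (_ + _); apply: eq_big_seq => i' i'r.
  by case: eqP => // e; rewrite -e i'r in ir.
exists y => c; rewrite mem_cat => /orP[|/allpairsP[[c1 c2] /=]].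
  rewrite mem_filter => /andP[/eqP ci cs]; have := hy c cs.
  by rewrite slackS ci mul0r addr0.
rewrite !mem_filter => -[/andP[ci1 c1s] /andP[ci2 c2s] ->]; rewrite slack_combine.
have := hy c1 c1s; have := hy c2 c2s; rewrite !slackS.
move: (slack _ _ _ _) (slack _ _ _ _) => u v; nra.
Qed.

End fourier_motzkin.

Definition pairing (R : realType) K (a f : 'cV[R]_K) : R := \sum_i a i 0 * f i 0.

Lemma pairingB (R : realType) K (a f g : 'cV[R]_K) :
  pairing a (f - g) = pairing a f - pairing a g.
Proof. by rewrite /pairing -sumrB; apply: eq_bigr => i _; rewrite !mxE mulrBr. Qed.

Lemma audit_objectiveE (R : realType) K (l f : 'cV[R]_K) (Pi : 'M[R]_K) :
  audit_objective l f Pi = \sum_i \sum_j l j 0 * Pi i j - \sum_i l i 0 * f i 0.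
Proof.
rewrite /audit_objective mxE exchange_big -sumrB; apply: eq_bigr => j _ /=.
rewrite !mxE mulrBr mulr_sumr; congr (_ - _); apply: eq_bigr => i _.
by rewrite !mxE mulr1.
Qed.

(** The hypograph of the value is the projection of a polyhedron in (t, f, Pi), with [None] indexing
    t. Attainment of the maximum gives the forward direction even at equality. *)
Lemma audit_value_halfline (R : realType) K (l : 'cV[R]_K) (eps : R)
    (C D : 'M[R]_K) :
  0 <= eps -> (forall i, C i i = 0) -> (forall i, D i i = 0) ->
  exists s : seq {ffun option 'I_K -> R}, forall f t, simplex f ->
  t <= audit_value l eps C D f <->
  (forall c, c \in s -> c None * t + \sum_i c (Some i) * f i 0 <= 0).
Proof.
move=> eps0 C0 D0.
pose I := ('I_K * 'I_K)%type.
pose ct : Type := constraint R (option 'I_K) I.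
pose mk (b : R) (u : 'I_K -> R) (v : 'I_K -> 'I_K -> R) : ct :=
  ([ffun o => if o is Some i then u i else b], [ffun ij => v ij.1 ij.2]).
(* Equalities are written as two opposite inequalities. The budget reads C.Pi - eps (sum of f) <= 0,
   and the fourth entry says that t is at most the objective. *)
pose s : seq ct :=
  [:: mk 0 (fun=> - eps) C; mk 0 (fun=> 0) D; mk 0 (fun=> 0) (fun i j => - D i j);
      mk 1 (fun i => l i 0) (fun _ j => - l j 0)] ++
  [seq mk 0 (fun=> 0) (fun i j => - ((i, j) == ij)%:R) | ij <- index_enum I] ++
  [seq mk 0 (fun i => - (i == i0)%:R) (fun i _ => (i == i0)%:R) | i0 <- index_enum 'I_K] ++
  [seq mk 0 (fun i => (i == i0)%:R) (fun i _ => - (i == i0)%:R) | i0 <- index_enum 'I_K].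
have [s' hs'] := fourier_motzkin (index_enum_uniq I) s.
exists s' => f t sf; have [f0 f1] := sf.
pose x (o : option 'I_K) := if o is Some i then f i 0 else t.
have xsum (c : {ffun option 'I_K -> R}) :
    \sum_o c o * x o = c None * t + \sum_i c (Some i) * f i 0.
  rewrite (bigD1 None)//= (reindex_omap Some id)/= => [|[]//].
  by congr (_ + _); apply: eq_bigl => i; rewrite eqxx.
have mkE b u v y : slack (index_enum I) x y (mk b u v) =
    b * t + \sum_i u i * f i 0 + \sum_i \sum_j v i j * y (i, j).
  rewrite /slack xsum /= !ffunE; congr (_ + _ + _).
    by apply: eq_bigr => i _; rewrite ffunE.
  by rewrite pair_bigA /=; apply: eq_bigr => -[i j] _; rewrite ffunE.
have delta1 (i0 : 'I_K) (w : 'I_K -> R) : \sum_i (i == i0)%:R * w i = w i0.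
  by rewrite (bigD1 i0)//= eqxx mul1r big1 ?addr0// => i /negbTE ->; rewrite mul0r.
have deltaN1 (i0 : 'I_K) (w : 'I_K -> R) : \sum_i - (i == i0)%:R * w i = - w i0.
  by rewrite -(delta1 i0 w) -sumrN; apply: eq_bigr => i _; rewrite mulNr.
have delta2 (i0 : 'I_K) (w : 'I_K -> 'I_K -> R) :
    \sum_i \sum_j (i == i0)%:R * w i j = \sum_j w i0 j.
  by rewrite -(delta1 i0 (fun i => \sum_j w i j)); apply: eq_bigr => i _; rewrite mulr_sumr.
have deltaN2 (i0 : 'I_K) (w : 'I_K -> 'I_K -> R) :
    \sum_i \sum_j - (i == i0)%:R * w i j = - \sum_j w i0 j.
  by rewrite -(deltaN1 i0 (fun i => \sum_j w i j)); apply: eq_bigr => i _; rewrite mulr_sumr.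
have delta3 (ij : I) (w : 'I_K -> 'I_K -> R) :
    \sum_i \sum_j - ((i, j) == ij)%:R * w i j = - w ij.1 ij.2.
  rewrite pair_bigA /= (bigD1 ij)//= -surjective_pairing eqxx mulN1r big1 ?addr0// => -[i j] /= /negbTE ->.
  by rewrite oppr0 mul0r.
have z0 : \sum_i 0 * f i 0 = 0 by rewrite big1// => i _; rewrite mul0r.
have e0 : \sum_i - eps * f i 0 = - eps by rewrite -mulr_sumr f1 mulr1.
have rowE (Pi : 'M[R]_K) i : (Pi *m const_mx 1 : 'cV[R]_K) i 0 = \sum_j Pi i j.
  by rewrite mxE; apply: eq_bigr => j _; rewrite mxE mulr1.
have oppsum (w w' : 'I_K -> 'I_K -> R) :
    \sum_i \sum_j - w i j * w' i j = - \sum_i \sum_j w i j * w' i j.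
  by rewrite -sumrN; apply: eq_bigr => i _; rewrite -sumrN; apply: eq_bigr => j _; rewrite mulNr.
have [Pi0 Fpi0 [Pi0v Pi0max]] := audit_value_max l eps0 C0 D0 sf.
have hx : (exists y, forall c, c \in s -> slack (index_enum I) x y c <= 0) <->
    (forall c, c \in s' -> c None * t + \sum_i c (Some i) * f i 0 <= 0).
  by rewrite hs'; split => h c cs; have := h c cs; rewrite xsum.
rewrite -hx; split.
  move=> tpsi; exists (fun ij => Pi0 ij.1 ij.2) => c; case: Fpi0 => P0 PC PD Pf.
  rewrite !mem_cat => /or4P[|/mapP[ij _ ->]|/mapP[i _ ->]|/mapP[i _ ->]].
  - rewrite !inE => /or4P[]/eqP ->; rewrite mkE /=.
    + by rewrite e0; move: PC; rewrite /mx_inner; lra.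
    + by rewrite z0; move: PD; rewrite /mx_inner; lra.
    + by rewrite z0 oppsum; move: PD; rewrite /mx_inner; lra.
    + rewrite (oppsum (fun _ j => l j 0)); move: Pi0v; rewrite audit_objectiveE; lra.
  - by rewrite mkE /= z0 (delta3 ij Pi0); have := P0 ij.1 ij.2; lra.
  - by rewrite mkE /= deltaN1 (delta2 i Pi0) -Pf rowE; lra.
  - by rewrite mkE /= delta1 (deltaN2 i Pi0) -Pf rowE; lra.
move=> [y hy]; pose Pi : 'M[R]_K := \matrix_(i, j) y (i, j).
have yE (w : 'I_K -> 'I_K -> R) : \sum_i \sum_j w i j * y (i, j) =
    \sum_i \sum_j w i j * Pi i j.
  by apply: eq_bigr => i _; apply: eq_bigr => j _; rewrite mxE.
have hin c : c \in s -> slack (index_enum I) x y c <= 0 by exact: hy.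
have h1 := hin (mk 0 (fun=> - eps) C); have h2 := hin (mk 0 (fun=> 0) D).
have h3 := hin (mk 0 (fun=> 0) (fun i j => - D i j)).
have h4 := hin (mk 1 (fun i => l i 0) (fun _ j => - l j 0)).
rewrite !mem_cat !inE eqxx ?orbT /= mkE yE in h1.
rewrite !mem_cat !inE eqxx ?orbT /= mkE yE in h2.
rewrite !mem_cat !inE eqxx ?orbT /= mkE yE in h3.
rewrite !mem_cat !inE eqxx ?orbT /= mkE yE in h4.
have FPi : audit_feasible eps C D f Pi.
  split.
  - move=> i j; have := hin (mk 0 (fun=> 0) (fun i' j' => - ((i', j') == (i, j))%:R)).
    rewrite !mem_cat (map_f (fun ij : I => mk 0 (fun=> 0) (fun i j => - ((i, j) == ij)%:R))) ?mem_index_enum// ?orbT => /(_ isT).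
    by rewrite mkE z0 (delta3 (i, j) (fun i j => y (i, j))) /= mxE; lra.
  - by move: (h1 isT); rewrite e0 /mx_inner; lra.
  - by move: (h2 isT) (h3 isT); rewrite oppsum z0 /mx_inner; lra.
  - apply/colP => i; rewrite rowE.
    have := hin (mk 0 (fun i' => - (i' == i)%:R) (fun i' _ => (i' == i)%:R)).
    rewrite !mem_cat (map_f (fun i0 => mk 0 (fun i => - (i == i0)%:R) (fun i _ => (i == i0)%:R))) ?mem_index_enum// ?orbT => /(_ isT).
    have := hin (mk 0 (fun i' => (i' == i)%:R) (fun i' _ => - (i' == i)%:R)).
    rewrite !mem_cat (map_f (fun i0 => mk 0 (fun i => (i == i0)%:R) (fun i _ => - (i == i0)%:R))) ?mem_index_enum// ?orbT => /(_ isT).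
    rewrite !mkE !yE delta1 deltaN1 (delta2 i Pi) (deltaN2 i Pi).
    by move=> u v; apply/eqP; rewrite eq_le; apply/andP; split; lra.
have := Pi0max Pi FPi; rewrite Pi0v; apply: le_trans; rewrite audit_objectiveE.
by move: (h4 isT); rewrite (oppsum (fun _ j => l j 0)); lra.
Qed.

Lemma audit_value_min_linear (R : realType) K (l : 'cV[R]_K) (eps : R)
    (C D : 'M[R]_K) :
  0 <= eps -> (forall i, C i i = 0) -> (forall i, D i i = 0) ->
  exists s : seq 'cV[R]_K, forall f, simplex f ->
  (forall a, a \in s -> audit_value l eps C D f <= pairing a f) /\
  (exists2 a, a \in s & audit_value l eps C D f = pairing a f).
Proof.
move=> eps0 C0 D0; have [s hs] := audit_value_halfline l eps0 C0 D0.
pose form (c : {ffun option 'I_K -> R}) : 'cV[R]_K := \col_i (- c (Some i) / c None).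
have formE (c : {ffun option 'I_K -> R}) f :
    pairing (form c) f = - (\sum_i c (Some i) * f i 0) / c None.
  by rewrite /pairing mulNr mulr_suml -sumrN; apply: eq_bigr => i _; rewrite mxE; ring.
pose forms := [seq form c | c <- [seq c : {ffun option 'I_K -> R} <- s | 0 < c None]].
exists forms => f sf.
set v := audit_value l eps C D f.
have hv t : t <= v <-> (forall c, c \in s -> c None * t + \sum_i c (Some i) * f i 0 <= 0).
  exact: hs.
have vs := (hv v).1 (lexx v).
(* A negative coefficient of t would bound the half-line from below, yet every t under [v] belongs
   to it. *)
have cN c : c \in s -> 0 <= c None.
  move=> cs; rewrite leNgt; apply/negP => cn.
  have := (hv (Num.min v ((1 - \sum_i c (Some i) * f i 0) / c None))).1.
  rewrite ge_min lexx => /(_ isT c cs); apply/negP; rewrite -ltNge.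
  set S := \sum_i _; set t := Num.min _ _.
  have : t <= (1 - S) / c None by rewrite ge_min lexx orbT.
  rewrite ler_ndivlMr// => h; lra.
have up a : a \in forms -> v <= pairing a f.
  move=> /mapP[c]; rewrite mem_filter => /andP[cn cs] ->.
  by rewrite formE ler_pdivlMr//; have := vs c cs; lra.
split => //; apply: contrapT => hne.
(* If no form attained [v], some t above [v] would still satisfy all constraints. This also covers
   an empty list of forms. *)
have [|t vt tU] := @exists_lower_bound R [seq pairing a f | a <- forms] v.
  move=> _ /mapP[a ain ->]; rewrite lt_neqAle up// andbT; apply/eqP => e.
  by apply: hne; exists a.
suff : t <= v by rewrite leNgt vt.
apply/hv => c cs; have := cN c cs; rewrite le_eqVlt => /predU1P[c0|cn].
  by have := vs c cs; rewrite -c0 !mul0r.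
have cf : form c \in forms by rewrite map_f// mem_filter cn.
have := tU _ (map_f (fun a => pairing a f) cf).
by rewrite formE ler_pdivlMr//; lra.
Qed.

Lemma norm1_seq_bound (R : realType) K (s : seq 'cV[R]_K) :
  exists2 L : R, 0 <= L & forall a, a \in s -> norm1 a <= L.
Proof.
exists (\sum_(a <- s) norm1 a); first by apply: sumr_ge0 => a _; exact: norm1_ge0.
by move=> a ains; rewrite (big_rem a)//= lerDl sumr_ge0// => b _; exact: norm1_ge0.
Qed.

Lemma pairing_le (R : realType) K (a h : 'cV[R]_K) (r : R) :
  (forall i, `|h i 0| <= r) -> `|pairing a h| <= norm1 a * r.
Proof.
move=> hr; rewrite /pairing /norm1 mulr_suml (le_trans (ler_norm_sum _ _ _))//.
by apply: ler_sum => i _; rewrite normrM ler_wpM2l.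
Qed.

Lemma min_linear_local (R : realType) K (psi : 'cV[R]_K -> R) (s : seq 'cV[R]_K) fstar :
  simplex fstar ->
  (forall f, simplex f -> (forall a, a \in s -> psi f <= pairing a f) /\
    (exists2 a, a \in s & psi f = pairing a f)) ->
  exists2 r : R, 0 < r & forall f, simplex f ->
    (forall a, a \in [seq a <- s | pairing a fstar == psi fstar] ->
       psi f - psi fstar <= pairing a (f - fstar)) /\
    ((forall i, `|f i 0 - fstar i 0| <= r) ->
     exists2 a, a \in [seq a <- s | pairing a fstar == psi fstar] &
       psi f - psi fstar = pairing a (f - fstar)).
Proof.
move=> sfs hs; have [up [a0 a0s a0E]] := hs _ sfs.
have [L L0 HL] := norm1_seq_bound s.
have [|g g0 hg] := @exists_lower_bound R
   [seq pairing a fstar | a <- s & psi fstar < pairing a fstar] (psi fstar).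
  by move=> _ /mapP[a + ->]; rewrite mem_filter => /andP[].
(* [g] separates the active value from the inactive ones. Forms move by at most [L * r], and 2 L r
   is below the gap, so no inactive form can become minimal. *)
pose r := (g - psi fstar) / (2 * L + 1) / 2.
have L1 : 0 < 2 * L + 1 by lra.
have r0 : 0 < r by rewrite !divr_gt0// subr_gt0.
have rL : 2 * (L * r) < g - psi fstar.
  have -> : g - psi fstar = 2 * (2 * L + 1) * r by rewrite /r; field; rewrite gt_eqF.
  by have := mulr_ge0 L0 (ltW r0); lra.
exists r => // f sf; have [upf [a ains aE]] := hs _ sf; split.
  move=> b; rewrite mem_filter pairingB => /andP[/eqP -> bs].
  by rewrite lerD2r upf.
move=> fr; suff act : pairing a fstar = psi fstar.
  by exists a; [rewrite mem_filter act eqxx|rewrite pairingB -aE act].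
have lip b : b \in s -> `|pairing b f - pairing b fstar| <= L * r.
  move=> bs; rewrite -pairingB; apply: (le_trans (pairing_le (r := r) _ _)).
    by move=> i; rewrite !mxE.
  by rewrite ler_wpM2r ?(ltW r0)// HL.
apply/eqP; rewrite eq_le up// andbT leNgt; apply/negP => lt.
have ga : g <= pairing a fstar.
  by apply: hg; apply: (map_f (fun a => pairing a fstar)); rewrite mem_filter lt.
have := upf a0 a0s; have := lip a ains; have := lip a0 a0s.
by rewrite !ler_norml => /andP[? ?] /andP[? ?] ?; lra.
Qed.

(** * Bootstrap tails and coverage *)

(* psi is, near fstar and on the face of fstar, the minimum of the rows of A
   (nondegenerate under Multinomial(fstar)) and, if z, of the zero form. *)
Record local_model (R : realType) K (psi : 'cV[R]_K -> R) (fstar : 'cV[R]_K)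
    k (A : 'M[R]_(k, K)) (z : Prop) (r : R) : Prop := LocalModel {
  lm_radius : 0 < r;
  lm_cov : forall a, 0 < cov_mx A fstar a a;
  lm_row : forall f, simplex f -> (forall i, fstar i 0 = 0 -> f i 0 = 0) ->
    forall a, psi f - psi fstar <= (A *m (f - fstar)) a 0;
  lm_zero : forall f, simplex f -> (forall i, fstar i 0 = 0 -> f i 0 = 0) ->
    z -> psi f <= psi fstar;
  lm_min : forall f, simplex f -> (forall i, fstar i 0 = 0 -> f i 0 = 0) ->
    (forall i, `|f i 0 - fstar i 0| <= r) ->
    (exists a, psi f - psi fstar = (A *m (f - fstar)) a 0) \/ (z /\ psi f = psi fstar) }.

Lemma local_model_exists (R : realType) K (l : 'cV[R]_K) (eps : R) (C D : 'M[R]_K) fstar :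
  0 <= eps -> (forall i, C i i = 0) -> (forall i, D i i = 0) -> simplex fstar ->
  exists k (A : 'M[R]_(k, K)) (z : Prop) (r : R),
    local_model (audit_value l eps C D) fstar A z r.
Proof.
move=> eps0 C0 D0 sfs; have [s hs] := audit_value_min_linear l eps0 C0 D0.
have [r r0 hr] := min_linear_local sfs hs.
set psi := audit_value l eps C D in hs hr *.
pose act := [seq a <- s | pairing a fstar == psi fstar].
pose var (a : 'cV[R]_K) := \sum_j fstar j 0 * (a j 0 - pairing a fstar) ^+ 2.
have [fs0 fs1] := sfs.
have var0 a : 0 <= var a by apply: sumr_ge0 => j _; rewrite mulr_ge0// sqr_ge0.
have vanish a f : var a = 0 -> simplex f -> (forall i, fstar i 0 = 0 -> f i 0 = 0) ->
    pairing a (f - fstar) = 0.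
  move=> va [f0 f1] fsupp.
  (* Zero variance makes the form constant on the support of [fstar]; on that face all points have
     mass 1, hence the same pairing. *)
  have aj j : fstar j 0 <> 0 -> a j 0 = pairing a fstar.
    move=> fj; have /eqP := @psumr_eq0P _ _ xpredT
      (fun j => fstar j 0 * (a j 0 - pairing a fstar) ^+ 2)
      (fun i _ => mulr_ge0 (fs0 i) (sqr_ge0 _)) va j isT.
    by rewrite mulf_eq0 => /orP[/eqP //|]; rewrite expf_eq0 /= subr_eq0 => /eqP.
  rewrite pairingB; apply/eqP; rewrite subr_eq0; apply/eqP.
  transitivity (\sum_j pairing a fstar * f j 0); last by rewrite -mulr_sumr f1 mulr1.
  apply: eq_bigr => j _; have [/fsupp ->|/eqP fj] := eqVneq (fstar j 0) 0.
    by rewrite !mulr0.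
  by rewrite aj.
pose nv := [seq a <- act | 0 < var a].
pose A : 'M[R]_(size nv, K) := \matrix_(i, j) (nth 0 nv i) j 0.
have AE h i : (A *m h) i 0 = pairing (nth 0 nv i) h.
  by rewrite mxE; apply: eq_bigr => j _; rewrite mxE.
exists (size nv), A, (exists2 a, a \in act & var a = 0), r; split => //.
- move=> i; have : nth 0 nv i \in nv by rewrite mem_nth.
  rewrite mem_filter => /andP[vi _]; rewrite (_ : cov_mx _ _ _ _ = var (nth 0 nv i))//.
  apply: eq_bigr => j _; rewrite centered_entry -expr2 mxE; congr (_ * (_ - _) ^+ 2).
  by apply: eq_bigr => j' _; rewrite mxE.
- move=> f sf fsupp i; rewrite AE; apply: (hr f sf).1.
  by have : nth 0 nv i \in nv by [rewrite mem_nth]; rewrite mem_filter => /andP[].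
- move=> f sf fsupp [a aact va]; rewrite -subr_le0 -(vanish a f va sf fsupp).
  exact: (hr f sf).1.
- move=> f sf fsupp fr; have [a aact e] := (hr f sf).2 fr.
  have [va|va] := eqVneq (var a) 0.
    right; split; first by exists a.
    by apply/eqP; rewrite -subr_eq0 e vanish.
  left; have ai : (index a nv < size nv)%N.
    by rewrite index_mem mem_filter aact lt0r va var0.
  exists (Ordinal ai); rewrite AE e /= nth_index//.
  by rewrite mem_filter aact lt0r va var0.
Qed.

Lemma uniform_anticoncentration (R : realType) k K (A : 'M[R]_(k, K))
    (p : 'cV[R]_K) (e : R) :
  simplex p -> (forall a, 0 < cov_mx A p a a) -> 0 < e ->
  exists2 w : R, 0 < w & exists2 B : R, 0 <= B & forall a n (x y : R), (0 < n)%N ->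
  y <= x + w ->
  prob (mexp n p) [set c | x <= deviation A n p c a 0 <= y] <=
  e + B / Num.sqrt n%:R.
Proof.
move=> sp cov0 e0.
have /choice[wB hwB] : forall a, exists wB : R * R, [/\ 0 < wB.1, 0 <= wB.2 &
   forall n (x : R), (0 < n)%N ->
   prob (mexp n p) [set c | x <= deviation A n p c a 0 <= x + wB.1] <=
   e + wB.2 / Num.sqrt n%:R].
  move=> a; have [w w0 [B B0 h]] := multinomial_anticoncentration sp (cov0 a) e0.
  by exists (w, B).
have [|w w0 hw] := @exists_lower_bound R [seq (wB a).1 | a <- enum 'I_k] 0.
  by move=> _ /mapP[a _ ->]; case: (hwB a).
exists w => //; exists (\sum_a (wB a).2).
  by apply: sumr_ge0 => a _; case: (hwB a).
move=> a n x y n0 yx; have [_ _ h] := hwB a.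
have wa : w <= (wB a).1 by apply: hw; apply: (map_f (fun a => (wB a).1)); rewrite mem_enum.
apply: (le_trans (_ : _ <= prob (mexp n p) [set c | x <= deviation A n p c a 0 <= x + (wB a).1])).
  apply: (prob_le (expectation_mexp n sp)) => c /= /andP[-> h2] /=; lra.
apply: (le_trans (h n x n0)); rewrite lerD2l ler_wpM2r ?invr_ge0 ?sqrtr_ge0//.
by rewrite (bigD1 a)//= lerDl sumr_ge0// => b _; case: (hwB b).
Qed.

Lemma mulmx_entry_le (R : realType) k K (A : 'M[R]_(k, K)) (h : 'cV[R]_K) (b d : R) a :
  0 <= d -> (forall a i, `|A a i| <= b) -> (forall i, `|h i 0| <= d) ->
  `|(A *m h) a 0| <= K%:R * b * d.
Proof.
move=> d0 Ab hd; rewrite mxE (le_trans (ler_norm_sum _ _ _))//.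
rewrite -mulrA mulr_natl -[K in _ *+ K]card_ord -sumr_const; apply: ler_sum => i _.
by rewrite normrM ler_pM.
Qed.

Section bootstrap_tails.
Context (R : realType) (K k : nat) (psi : 'cV[R]_K -> R) (fstar : 'cV[R]_K)
  (A : 'M[R]_(k, K)) (z : Prop) (r : R).
Hypotheses (sfs : simplex fstar) (hlm : local_model psi fstar A z r).

Definition statistic n (f0 : 'cV[R]_K) (c : 'I_K -> nat) : R :=
  Num.sqrt n%:R * (psi (freq R n c) - psi f0).

Lemma sqrtn_gt0 n : (0 < n)%N -> 0 < Num.sqrt n%:R :> R.
Proof. by move=> n0; rewrite sqrtr_gt0 ltr0n. Qed.

Lemma sqrtn_ge1 n : (0 < n)%N -> 1 <= Num.sqrt n%:R :> R.
Proof. by move=> n0; rewrite -[leLHS]sqrtr1 ler_wsqrtr// ler1n. Qed.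

Lemma statistic_le_deviation n c a : (0 < n)%N -> counts_support n fstar c ->
  statistic n fstar c <= deviation A n fstar c a 0.
Proof.
move=> n0 hc; rewrite /statistic /deviation mxE ler_wpM2l ?sqrtr_ge0//.
by apply: (lm_row hlm) => [|i]; [exact: freq_simplex hc|exact: freq_support hc].
Qed.

(** Recentring perturbs the statistic by at most [2 * d1], at most w/2, and smoothing costs another
    w/2. The total stays within the window [w] in which every form has small probability. *)
Lemma bootstrap_tails (e : R) : 0 < e ->
  exists2 d0 : R, 0 < d0 & exists2 B : R, 0 <= B &
  forall n m c, (0 < n)%N -> (0 < m)%N -> counts_support n fstar c ->
  (forall i, `|freq R n c i 0 - fstar i 0| <= d0 / Num.sqrt m%:R) ->
  let f := freq R n c in let x := statistic n fstar c in
  let err := e + B * ((Num.sqrt n%:R)^-1 + (Num.sqrt m%:R)^-1) in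
  prob (mexp n fstar) [set c | statistic n fstar c <= x] <=
    prob (mexp m f) [set c | statistic m f c <= x] + err /\
  prob (mexp n fstar) [set c | x <= statistic n fstar c] <=
    prob (mexp m f) [set c | x <= statistic m f c] + err.
Proof.
move=> e0; have r0 := lm_radius hlm.
pose e' := e / (k%:R + 1).
have k1 : 0 < k%:R + 1 :> R by rewrite ltr_wpDl.
have e'0 : 0 < e' by rewrite divr_gt0.
have ke' : k%:R * e' <= e.
  by rewrite /e' mulrA ler_pdivrMr// mulrC ler_wpM2l ?(ltW e0)// lerDl.
have [w w0 [B1 B10 hanti]] := uniform_anticoncentration sfs (lm_cov hlm) e'0.
have [b b0 Ab] := entry_bound A.
have d60 : 0 < w / 6 by rewrite divr_gt0.
have [B2 B20 hbox] := multinomial_box_compare A d60.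
(* The first bound keeps f_n within r/2 of [fstar], leaving r/2 for the bootstrap draw; the second
   makes [d1] at most w/4. *)
pose d0 := Num.min (r / 2) (w / 4 / (K%:R * b + 1)).
have Kb : 0 <= K%:R * b by rewrite mulr_ge0.
have Kb1 : 0 < K%:R * b + 1 by lra.
have d00 : 0 < d0 by rewrite lt_min !divr_gt0.
have d0r : d0 <= r / 2 by rewrite ge_min lexx.
pose d1 := K%:R * b * d0.
have d10 : 0 <= d1 by rewrite mulr_ge0// ltW.
have d1w : d1 <= w / 4.
  have : d0 <= w / 4 / (K%:R * b + 1) by rewrite ge_min lexx orbT.
  by rewrite ler_pdivlMr// /d1; lra.
exists d0 => //.
pose Bf := 4 * K%:R / r ^+ 2.
have Bf0 : 0 <= Bf by rewrite divr_ge0 ?mulr_ge0 ?exprn_ge0 ?(ltW r0).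
have kB0 : 0 <= k%:R * B1 by rewrite mulr_ge0.
have Kd0 : 0 <= K%:R * d0 by rewrite mulr_ge0// ltW.
have B0 : 0 <= k%:R * B1 + B2 * (K%:R * d0 + 1) + Bf.
  by rewrite addr_ge0// addr_ge0// mulr_ge0// addr_ge0.
exists (k%:R * B1 + B2 * (K%:R * d0 + 1) + Bf) => //.
move=> n m c n0 m0 hc cnear f x err.
have err0 : 0 <= err.
  apply: addr_ge0; first exact: ltW.
  by apply: mulr_ge0; rewrite // addr_ge0 ?invr_ge0 ?sqrtr_ge0.
have sn := sqrtn_gt0 n0; have sm := sqrtn_gt0 m0.
have sf : simplex f := freq_simplex n0 hc.
have fsupp i : fstar i 0 = 0 -> f i 0 = 0 by exact: freq_support hc.
have sm1 := sqrtn_ge1 m0; have sn1 := sqrtn_ge1 n0.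
have near2 i : `|f i 0 - fstar i 0| <= r / 2.
  apply: (le_trans (cnear i)); rewrite ler_pdivrMr//.
  by apply: (le_trans d0r); rewrite ler_peMr// ltW// divr_gt0.
have near1 i : `|f i 0 - fstar i 0| <= r by apply: (le_trans (near2 i)); lra.
pose v := Num.sqrt m%:R *: (f - fstar).
have vle i : `|v i 0| <= d0.
  rewrite !mxE normrM ger0_norm ?sqrtr_ge0// mulrC -ler_pdivlMr//.
  by have := cnear i; rewrite /f !mxE.
have Av a : `|(A *m v) a 0| <= d1 by apply: mulmx_entry_le => //; exact: ltW.
have AvE a : (A *m v) a 0 = Num.sqrt m%:R * (A *m (f - fstar)) a 0.
  by rewrite /v -scalemxAr mxE.
have n1f : norm1 (f - fstar) <= K%:R * d0 * (Num.sqrt m%:R)^-1.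
  rewrite -mulrA mulr_natl -[K in _ *+ K]card_ord -sumr_const; apply: ler_sum => i _.
  by rewrite !mxE; have := cnear i; rewrite /f !mxE.
have n1f' : norm1 (fstar - f) <= K%:R * d0 * (Num.sqrt m%:R)^-1.
  by rewrite -opprB /norm1; under eq_bigr do rewrite mxE normrN; exact: n1f.
have En := expectation_mexp n sfs; have Em := expectation_mexp m sf.
have csup c' : counts_support m f c' ->
    simplex (freq R m c') /\ (forall i, fstar i 0 = 0 -> freq R m c' i 0 = 0).
  move=> hc'; split; first exact: freq_simplex hc'.
  by move=> i /fsupp; exact: freq_support hc'.
have devm c' a : Num.sqrt m%:R * (A *m (freq R m c' - fstar)) a 0 =
    deviation A m f c' a 0 + (A *m v) a 0.
  rewrite AvE /deviation [X in _ = X + _]mxE -mulrDr; congr (_ * _).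
  by rewrite -[freq R m c' - fstar](subrKA f) mulmxDr mxE.
have statm c' : statistic m f c' = Num.sqrt m%:R * (psi (freq R m c') - psi fstar) -
    Num.sqrt m%:R * (psi f - psi fstar).
  by rewrite /statistic; ring.
have anti a (y y' : R) : y' <= y + w ->
    prob (mexp n fstar) [set c | y <= deviation A n fstar c a 0 <= y'] <=
    e' + B1 / Num.sqrt n%:R by exact: hanti.
have antisum (y y' : R) : y' <= y + w ->
    prob (mexp n fstar) [set c | exists a, y <= deviation A n fstar c a 0 <= y'] <=
    e + k%:R * B1 / Num.sqrt n%:R.
  move=> yy; apply: (le_trans (prob_bigcup En _)).
  apply: (le_trans (_ : _ <= \sum_(a < k) (e' + B1 / Num.sqrt n%:R))).
    by apply: ler_sum => a _; exact: anti.
  have -> : \sum_(a < k) (e' + B1 / Num.sqrt n%:R) = k%:R * (e' + B1 / Num.sqrt n%:R).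
    by rewrite sumr_const card_ord mulr_natl.
  by rewrite mulrDr [X in _ + X]mulrA lerD2r.
pose far j (f0 : 'cV[R]_K) := [set c | exists i, r / 2 <= `|freq R j c i 0 - f0 i 0|].
have farle j f0 : (0 < j)%N -> simplex f0 ->
    prob (mexp j f0) (far j f0) <= Bf * (Num.sqrt j%:R)^-1.
  move=> j0 sf0; have sj := sqrtn_gt0 j0.
  have r20 : 0 < r / 2 by rewrite divr_gt0.
  apply: (le_trans (multinomial_chebyshev j0 sf0 r20)).
  have -> : K%:R / (j%:R * (r / 2) ^+ 2) = Bf * (Num.sqrt j%:R)^-1 * (Num.sqrt j%:R)^-1.
    rewrite -[j%:R in LHS]sqr_sqrtr// /Bf; field.
    by rewrite !gt_eqF.
  have si : 0 <= (Num.sqrt j%:R)^-1 :> R by rewrite invr_ge0 sqrtr_ge0.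
  by apply: ler_piMr; [exact: mulr_ge0|rewrite invf_le1// sqrtn_ge1].
have errE (N : R) : N <= K%:R * d0 * (Num.sqrt m%:R)^-1 ->
    e + k%:R * B1 / Num.sqrt n%:R +
    B2 * (N + (Num.sqrt n%:R)^-1 + (Num.sqrt m%:R)^-1) +
    Bf * (Num.sqrt n%:R)^-1 <= err /\
    e + k%:R * B1 / Num.sqrt n%:R +
    B2 * (N + (Num.sqrt n%:R)^-1 + (Num.sqrt m%:R)^-1) +
    Bf * (Num.sqrt m%:R)^-1 <= err.
  move=> hN; rewrite /err.
  have s0 : 0 <= (Num.sqrt n%:R)^-1 :> R by rewrite invr_ge0 sqrtr_ge0.
  have t0 : 0 <= (Num.sqrt m%:R)^-1 :> R by rewrite invr_ge0 sqrtr_ge0.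
  move: hN s0 t0; set s := (Num.sqrt n%:R)^-1; set t := (Num.sqrt m%:R)^-1 => hN s0 t0.
  have hBN := ler_wpM2l B20 hN.
  have kB : 0 <= k%:R * B1 by rewrite mulr_ge0.
  have Kd : 0 <= B2 * (K%:R * d0) by rewrite !mulr_ge0// ltW.
  have := mulr_ge0 kB t0; have := mulr_ge0 Kd s0.
  have := mulr_ge0 Bf0 s0; have := mulr_ge0 Bf0 t0 => p1 p2 p3 p4.
  by clear -hBN p1 p2 p3 p4; split; lra.
have sx0 : z -> x <= 0.
  move=> hz; rewrite /x /statistic pmulr_rle0// subr_le0.
  by apply: (lm_zero hlm).
(* One [d1] pays for this term and one for the shift [A *m v] of the form. *)
have psi_v : Num.sqrt m%:R * (psi f - psi fstar) >= - d1.
  have [[a ->]|[_ ->]] := lm_min hlm sf fsupp near1; last by rewrite subrr mulr0 oppr_le0.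
  by rewrite -AvE; have := Av a; rewrite ler_norml => /andP[].
split.
- have [[hz x0]|hzx] := pselect (z /\ x = 0).
    have psie : psi f = psi fstar.
      by move/eqP: x0; rewrite /x /statistic mulf_eq0 gt_eqF//= subr_eq0 => /eqP.
    apply: (le_trans (_ : _ <= 1)).
      rewrite -[leRHS](exp_cst En); apply: (exp_le En) => c'.
      by case: asbool.
    apply: (le_trans (_ : _ <= prob (mexp m f) [set c | statistic m f c <= x])); last first.
      by rewrite lerDl.
    apply: (le_trans (_ : _ <= prob (mexp m f) setT)).
      by rewrite -[leLHS](exp_cst Em); apply: (exp_le Em) => c'; rewrite asboolT.
    apply: prob_mexp_le => // c' hc' _ /=; rewrite x0 statm psie subrr mulr0 subr0.
    by rewrite pmulr_rle0// subr_le0; have [h1 h2] := csup _ hc'; apply: (lm_zero hlm).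
  pose y := x - 2 * d1.
  have h1 : prob (mexp n fstar) [set c | statistic n fstar c <= x] <=
      Bf * (Num.sqrt n%:R)^-1 +
      (1 - prob (mexp n fstar) [set c | forall a, x < deviation A n fstar c a 0]).
    rewrite -(probC En).
    apply: (le_trans _ (lerD (farle n fstar n0 sfs) (lexx _))).
    apply: (le_trans _ (prob_setU En _ _)); apply: prob_mexp_le => // c' hc' /= cx.
    have [hf|hf] := pselect (far n fstar c'); [by left|right => hall].
    have nearc i : `|freq R n c' i 0 - fstar i 0| <= r.
      by rewrite leNgt; apply/negP => h; apply: hf; exists i; lra.
    (* If the zero form is minimal, the statistic is 0, so x >= 0; with x <= 0 this is the atom
       already excluded. *)
    have [[a ea]|[hz ez]] := lm_min hlm (freq_simplex n0 hc')
      (fun i => freq_support hc') nearc.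
      have := hall a; rewrite /deviation mxE -ea => h.
      by move: cx; rewrite /statistic leNgt h.
    have := sx0 hz; rewrite le_eqVlt => /predU1P[xe|]; first exact: hzx.
    by move: cx; rewrite /statistic ez subrr mulr0 => /le_lt_trans h /h; rewrite ltxx.
  have h2 : prob (mexp n fstar) [set c | forall a, y - 3 * (w / 6) < deviation A n fstar c a 0] <=
      prob (mexp n fstar) [set c | forall a, x < deviation A n fstar c a 0] +
      (e + k%:R * B1 / Num.sqrt n%:R).
    have yx : x <= y - 3 * (w / 6) + w by rewrite /y; lra.
    apply: (le_trans _ (lerD (lexx _) (antisum _ _ yx))).
    apply: (le_trans _ (prob_setU En _ _)); apply: (prob_le En) => c' /= hall.
    have [h|/existsNP[a /negP]] := pselect (forall a, x < deviation A n fstar c' a 0).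
      by left.
    by rewrite -leNgt => ha; right; exists a; rewrite ha (ltW (hall a)).
  have h3 := hbox m n f fstar (y - 3 * (w / 6)) m0 n0 sf sfs.
  rewrite subrK in h3.
  have h4 : 1 - prob (mexp m f) [set c | forall a, y <= deviation A m f c a 0] <=
      prob (mexp m f) [set c | statistic m f c <= x].
    rewrite -(probC Em); apply: prob_mexp_le => // c' hc' /= /existsNP[a /negP].
    rewrite -ltNge => ha; have [h5 h6] := csup _ hc'.
    have := lm_row hlm h5 h6 a; rewrite -(ler_pM2l sm) devm => h7.
    rewrite statm; have := Av a; rewrite ler_norml => /andP[_ h8].
    by move: ha; rewrite /y; lra.
  have [h5 _] := errE _ n1f; lra.
- pose y := x + 2 * d1.
  have h1 : prob (mexp n fstar) [set c | x <= statistic n fstar c] <=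
      prob (mexp n fstar) [set c | forall a, y + 3 * (w / 6) <= deviation A n fstar c a 0] +
      (e + k%:R * B1 / Num.sqrt n%:R).
    have yx : y + 3 * (w / 6) <= x + w by rewrite /y; lra.
    apply: (le_trans _ (lerD (lexx _) (antisum _ _ yx))).
    apply: (le_trans _ (prob_setU En _ _)); apply: prob_mexp_le => // c' hc' /= cx.
    have [h|/existsNP[a /negP]] := pselect (forall a, y + 3 * (w / 6) <= deviation A n fstar c' a 0).
      by left.
    rewrite -ltNge => ha; right; exists a; rewrite (ltW ha) andbT.
    by apply: (le_trans cx); exact: statistic_le_deviation.
  have h2 := hbox n m fstar f y n0 m0 sfs sf.
  have h3 : prob (mexp m f) [set c | forall a, y < deviation A m f c a 0] <=
      prob (mexp m f) [set c | x <= statistic m f c] + Bf * (Num.sqrt m%:R)^-1.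
    apply: (le_trans _ (lerD (lexx _) (farle m f m0 sf))).
    apply: (le_trans _ (prob_setU Em _ _)); apply: prob_mexp_le => // c' hc' /= hall.
    have [hf|hf] := pselect (far m f c'); [by right|left].
    have [h5 h6] := csup _ hc'.
    have nearc i : `|freq R m c' i 0 - fstar i 0| <= r.
      rewrite -[freq R m c' i 0 - _](subrKA (f i 0)) (le_trans (ler_normD _ _))//.
      have : `|freq R m c' i 0 - f i 0| <= r / 2.
        by rewrite leNgt; apply/negP => h; apply: hf; exists i; exact: ltW.
      by have := near2 i; lra.
    rewrite statm; have [[a ea]|[hz ez]] := lm_min hlm h5 h6 nearc.
      have := lm_row hlm sf fsupp a; rewrite -(ler_pM2l sm) -AvE ea devm => h7.
      have := Av a; rewrite ler_norml => /andP[h8 h9].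
      by have := hall a; rewrite /y; lra.
    (* The atom is harmless in the upper tail: a draw where the zero form is minimal has statistic
       -sqrt m (psi f - psi fstar) >= 0 >= x. *)
    rewrite ez subrr mulr0 sub0r; apply: (le_trans (sx0 hz)).
    by rewrite oppr_ge0 pmulr_rle0// subr_le0; apply: (lm_zero hlm).
  have [_ h5] := errE _ n1f'; lra.
Qed.

End bootstrap_tails.

(** A discrete probability integral transform: the set lies below its own element with largest [X],
    and the lower tail at that element is at most [u]. *)
Lemma prob_rank_le (R : realType) K n (p : 'cV[R]_K) (X : ('I_K -> nat) -> R) (u : R) :
  simplex p -> 0 <= u ->
  prob (mexp n p) [set c | prob (mexp n p) [set c' | X c' <= X c] <= u] <= u.
Proof.
move=> sp u0; set S := [set c | _ <= u].
pose cnt (k : {ffun 'I_K -> 'I_n.+1}) : 'I_K -> nat := fun i => k i.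
have [[k0 Sk0]|h] := pselect (exists k, S (cnt k)); last first.
  rewrite /prob /mexp big1// => k _; rewrite asboolF ?mulr0// => Sk.
  by apply: h; exists k.
case: (@Order.TotalTheory.arg_maxP _ R _ k0 (fun k => `[< S (cnt k) >]) (X \o cnt)).
  exact/asboolP.
move=> k1 /asboolP Sk1 k1max; apply: le_trans Sk1.
apply: ler_sum => k _; rewrite ler_wpM2l ?multinomial_pmf_ge0// ler_nat -/(cnt k).
by case: asboolP => // Sk; rewrite asboolT//=; apply: k1max; exact/asboolP.
Qed.

(** * Tail bounds on either side of a bootstrap quantile *)

Section quantiles.
Context (R : realType) (K : nat) (psi : 'cV[R]_K -> R) (m : nat) (f : 'cV[R]_K).
Hypothesis sf : simplex f.

Lemma bootstrap_cdfE x :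
  bootstrap_cdf psi m f x = prob (mexp m f) [set c | statistic psi m f c <= x].
Proof. exact: multinomial_lawE. Qed.

Let cnt (k : {ffun 'I_K -> 'I_m.+1}) : 'I_K -> nat := fun i => k i.
Let bound : R := \sum_k `|statistic psi m f (cnt k)|.

Lemma statistic_bound k : `|statistic psi m f (cnt k)| <= bound.
Proof. by rewrite /bound (bigD1 k)//= lerDl sumr_ge0. Qed.

Lemma lt_bootstrap_quantile q x : 0 < q -> x < bootstrap_quantile psi m f q ->
  prob (mexp m f) [set c | statistic psi m f c <= x] < q.
Proof.
move=> q0 xq; rewrite -bootstrap_cdfE ltNge; apply/negP => qx.
suff : bootstrap_quantile psi m f q <= x by rewrite leNgt xq.
(* Below [- bound] the bootstrap distribution function is 0 < q, so the set defining the quantile is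
   bounded below and [inf] is not a default value. *)
apply: ge_inf => //; exists (- bound) => y /= qy; rewrite leNgt; apply/negP => yb.
move: qy; rewrite leNgt => /negP; apply; apply: le_lt_trans q0.
rewrite bootstrap_cdfE /prob /mexp big1// => k _; rewrite asboolF ?mulr0//= => ky.
by have := statistic_bound k; rewrite ler_norml /cnt => /andP[h _]; lra.
Qed.

Lemma gt_bootstrap_quantile q x : q <= 1 -> bootstrap_quantile psi m f q < x ->
  prob (mexp m f) [set c | x <= statistic psi m f c] <= 1 - q.
Proof.
have E := expectation_mexp m sf.
move=> q1 /inf_lt[|y /= qy yx].
  exists bound => /=; rewrite bootstrap_cdfE (le_trans q1)// -[leLHS](exp_cst E).
  apply: ler_sum => k _; rewrite ler_wpM2l ?multinomial_pmf_ge0// asboolT//=.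
  by rewrite (le_trans (ler_norm _))// statistic_bound.
apply: (le_trans (_ : _ <= 1 - bootstrap_cdf psi m f y)); last by rewrite lerD2l lerN2.
rewrite bootstrap_cdfE -(probC E); apply: (prob_le E) => c /= xc cy.
by have := lt_le_trans yx (le_trans xc cy); rewrite ltxx.
Qed.

End quantiles.

Lemma limn_einf_ge (R : realType) (u : (\bar R)^nat) (x : R) :
  (forall e : R, 0 < e -> \forall n \near \oo, ((x - e)%:E <= u n)%E) ->
  (x%:E <= limn_einf u)%E.
Proof.
move=> h; rewrite limn_einf_lim (cvg_lim _ (@cvg_einfs_sup _ u))//.
apply/lee_addgt0Pr => e e0; have [N _ hN] := h e e0.
rewrite -leeBlDr//; apply: (le_trans (_ : _ <= einfs u N)%E); last first.
  by apply: ereal_sup_ubound; exists N.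
by apply: le_ereal_inf_tmp => _ [n /= Nn <-]; exact: hN.
Qed.

Lemma inv_sqrt_small (R : realType) (eta : R) : 0 < eta ->
  exists N : nat, forall j, (N <= j)%N -> (0 < j)%N /\ (Num.sqrt j%:R)^-1 <= eta.
Proof.
move=> eta0; exists (Num.truncn (eta^-1 ^+ 2)).+1 => j Nj.
have j0 : (0 < j)%N by apply: leq_trans Nj.
split => //; rewrite -[leRHS]invrK lef_pV2 ?posrE ?invr_gt0// ?sqrtr_gt0 ?ltr0n//.
have e2 : 0 <= eta^-1 ^+ 2 := sqr_ge0 _.
rewrite -[leLHS]ger0_norm ?invr_ge0 ?(ltW eta0)// -sqrtr_sqr ler_wsqrtr//.
by apply: (le_trans (ltW (truncnS_gt _))); rewrite ler_nat.
Qed.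

(** * Coverage probability *)

Section coverage.
Context (R : realType) (K : nat) (l : 'cV[R]_K) (eps : R) (C D : 'M[R]_K)
  (alpha : R) (m : nat -> nat) (fstar : 'cV[R]_K).
Hypotheses (heps : 0 <= eps) (hC0 : forall i, C i i = 0) (hD0 : forall i, D i i = 0)
  (halpha : 0 < alpha < 1) (hm : m @ \oo --> \oo)
  (hmn : (fun n => (m n)%:R / n%:R : R) @ \oo --> (0 : R)) (hfstar : simplex fstar).

Let psi := audit_value l eps C D.

Definition covers n (c : 'I_K -> nat) : Prop :=
  psi fstar \in
   `[psi (freq R n c) - bootstrap_quantile psi (m n) (freq R n c) (1 - alpha / 2) / Num.sqrt n%:R,
     psi (freq R n c) - bootstrap_quantile psi (m n) (freq R n c) (alpha / 2) / Num.sqrt n%:R]%R.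

Lemma not_covers n c : (0 < n)%N -> ~ covers n c ->
  statistic psi n fstar c < bootstrap_quantile psi (m n) (freq R n c) (alpha / 2) \/
  bootstrap_quantile psi (m n) (freq R n c) (1 - alpha / 2) < statistic psi n fstar c.
Proof.
move=> n0; rewrite /covers in_itv /= => /negP; rewrite negb_and -!ltNge.
have sn : 0 < Num.sqrt n%:R :> R by exact: sqrtn_gt0.
rewrite /statistic => /orP[h|h]; [right|left].
  by rewrite [ltRHS]mulrC -ltr_pdivrMr//; lra.
by rewrite [ltLHS]mulrC -ltr_pdivlMr//; lra.
Qed.

(** Error budget: each of the two ranks costs alpha/2 + e/4 and the event [bad] costs e/4, in total
    alpha + 3e/4. *)
Lemma coverage_near (e : R) : 0 < e ->
  \forall n \near \oo, 1 - alpha - e <= prob (mexp n fstar) [set c | covers n c].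
Proof.
move=> e0; have [a0 a1] := andP halpha.
have [k [A [z [r hlm]]]] := local_model_exists l heps hC0 hD0 hfstar.
have e80 : 0 < e / 8 by rewrite divr_gt0.
have [d0 d00 [B B0 tails]] := bootstrap_tails hfstar hlm e80.
pose eta := e / 16 / (B + 1).
have B1 : 0 < B + 1 by lra.
have eta0 : 0 < eta by rewrite !divr_gt0.
have [N hN] := inv_sqrt_small eta0.
pose kap := e / 4 / (K%:R / d0 ^+ 2 + 1).
have Kd0 : 0 <= K%:R / d0 ^+ 2 by rewrite divr_ge0// exprn_ge0// ltW.
have Kd1 : 0 < K%:R / d0 ^+ 2 + 1 by lra.
have kap0 : 0 < kap by rewrite !divr_gt0.
have nearn := nbhs_infty_ge N.
have nearm : \forall n \near \oo, (N <= m n)%N := hm (nbhs_infty_ge N).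
have nearmn : \forall n \near \oo, `|(m n)%:R / n%:R : R| < kap.
  by move/cvgr0Pnorm_lt : hmn; apply.
apply: filterS3 nearn nearm nearmn => n Nn Nm; rewrite ger0_norm// => mn.
have [n0 sn] := hN n Nn; have [m0 sm] := hN (m n) Nm.
have E := expectation_mexp n hfstar.
pose err := e / 8 + B * ((Num.sqrt n%:R)^-1 + (Num.sqrt (m n)%:R)^-1).
have errle : err <= e / 4.
  have : B * ((Num.sqrt n%:R)^-1 + (Num.sqrt (m n)%:R)^-1) <= (B + 1) * (eta + eta).
    by apply: ler_pM; rewrite ?addr_ge0 ?invr_ge0 ?sqrtr_ge0 ?lerD//; lra.
  have -> : (B + 1) * (eta + eta) = e / 8 by rewrite /eta; field; rewrite gt_eqF.
  by rewrite /err; lra.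
have err0 : 0 <= err.
  by rewrite addr_ge0 ?(ltW e80)// mulr_ge0// addr_ge0 ?invr_ge0 ?sqrtr_ge0.
pose T := statistic psi n fstar.
pose S1 := [set c | prob (mexp n fstar) [set c' | T c' <= T c] <= alpha / 2 + err].
(* The sign change turns the upper tail into a lower one, so the same rank bound applies. *)
pose S2 := [set c | prob (mexp n fstar) [set c' | - T c' <= - T c] <= alpha / 2 + err].
have s0 : 0 < d0 / Num.sqrt (m n)%:R by rewrite divr_gt0// sqrtn_gt0.
pose bad := [set c | exists i, d0 / Num.sqrt (m n)%:R <= `|freq R n c i 0 - fstar i 0|].
have u0 : 0 <= alpha / 2 + err by lra.
have h1 : prob (mexp n fstar) S1 <= alpha / 2 + err := prob_rank_le n T hfstar u0.
have h2 : prob (mexp n fstar) S2 <= alpha / 2 + err.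
  exact: (prob_rank_le n (fun c => - T c) hfstar u0).
(* Chebyshev at radius d0/sqrt m gives K m/(n d0^2); this is where m/n tending to 0 enters. *)
have h3 : prob (mexp n fstar) bad <= e / 4.
  apply: (le_trans (multinomial_chebyshev n0 hfstar s0)).
  have -> : K%:R / (n%:R * (d0 / Num.sqrt (m n)%:R) ^+ 2) =
      K%:R / d0 ^+ 2 * ((m n)%:R / n%:R).
    have n0' : n%:R != 0 :> R by rewrite pnatr_eq0 -lt0n.
    have sm0 : Num.sqrt (m n)%:R != 0 :> R by rewrite gt_eqF// sqrtn_gt0.
    rewrite -[(m n)%:R in RHS]sqr_sqrtr//; field.
    by rewrite n0' sm0 gt_eqF.
  apply: (le_trans (_ : _ <= (K%:R / d0 ^+ 2 + 1) * kap)).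
    by apply: ler_pM => //; [rewrite lerDl|exact: ltW].
  by rewrite /kap mulrC divfK// gt_eqF.
have : prob (mexp n fstar) (~` [set c | covers n c]) <=
    prob (mexp n fstar) (bad `|` (S1 `|` S2)).
  apply: prob_mexp_le => // c hc /= ncov.
  have [hbad|hbad] := pselect (bad c); [by left|right].
  have near_c i : `|freq R n c i 0 - fstar i 0| <= d0 / Num.sqrt (m n)%:R.
    by rewrite leNgt; apply/negP => h; apply: hbad; exists i; exact: ltW.
  have sf := freq_simplex n0 hc.
  have [t1 t2] := tails n (m n) c n0 m0 hc near_c.
  have [lo|hi] := not_covers n0 ncov; [left|right].
    have q0 : 0 < alpha / 2 by rewrite divr_gt0.
    have h := ltW (lt_bootstrap_quantile q0 lo).
    by rewrite /S1 /=; apply: (le_trans t1); rewrite lerD2r.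
  have q1 : 1 - alpha / 2 <= 1 by rewrite gerBl divr_ge0// ltW.
  have h := gt_bootstrap_quantile sf q1 hi; rewrite subKr in h.
  rewrite /S2 /=; under eq_set do rewrite lerN2.
  by apply: (le_trans t2); rewrite lerD2r.
rewrite (probC E) => h; have := le_trans h (prob_setU E _ _).
have := prob_setU E S1 S2; lra.
Qed.

End coverage.

Unset Implicit Arguments.
Set Strict Implicit.

Theorem theorem4p3 (R : realType) (K : nat) (hK : (1 <= K)%N)
    (l : 'cV[R]_K) (hl : forall i, 0 <= l i 0)
    (eps : R) (heps : 0 <= eps)
    (C : 'M[R]_K) (hC : forall i j, 0 <= C i j) (hC0 : forall i, C i i = 0)
    (D : 'M[R]_K) (hD : forall i j, D i j = 0 \/ D i j = 1)
    (hD0 : forall i, D i i = 0)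
    (alpha : R) (halpha : 0 < alpha < 1)
    (m : nat -> nat) (hm : m @ \oo --> \oo)
    (hmn : (fun n => (m n)%:R / n%:R : R) @ \oo --> (0 : R))
    (fstar : 'cV[R]_K) (hfstar : simplex fstar)
    (d : measure_display) (T : measurableType d) (P : probability T R)
    (N : nat -> 'I_K -> {RV P >-> nat})
    (hN : forall n, multinomial_rv n fstar (N n)) :
  let psi := audit_value l eps C D in
  let f n w := @freq R K n (fun i => N n i w) in
  let c n w q := bootstrap_quantile psi (m n) (f n w) q in
  ((1 - alpha)%:E <=
   limn_einf (fun n => P [set w |
     psi fstar \in `[psi (f n w) - c n w (1 - alpha / 2) / Num.sqrt n%:R,
                     psi (f n w) - c n w (alpha / 2) / Num.sqrt n%:R]%R ]))%E.
Proof.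
cbv zeta; apply: limn_einf_ge => e e0.
apply: filterS (coverage_near l heps hC0 hD0 halpha hm hmn hfstar e0) => n.
rewrite -lee_fin.
by rewrite -(probability_multinomial (covers l eps C D alpha m fstar n) hfstar (hN n)).
Qed.
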